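(* Let $G_0(z):=1$ and, for $n\in\mathbb{N}$, let $G_n(z)=\sum_{k=1}^n\mathbb{P}(f_0(T_n)=k)\,z^k$ be the probability generating function of the number $f_0(T_n)$ of vertices of the random convex chain $T_n$. Then $G_0(z)=1$, $G_1(z)=z$, and for all integers $n\geq 2$ and all $z\in\mathbb{R}$, $$G_n(z)=(a_nz+b_n)\,G_{n-1}(z)-c_n\,G_{n-2}(z),$$ where $$a_n:=\frac{2}{n(n+1)},\qquad b_n:=2\,\frac{n-1}{n+1},\qquad c_n:=\frac{(n-1)(n-2)}{n(n+1)}.$$
   Context: Let $\mathbb{N}=\{1,2,\ldots\}$. Let $T\subset\mathbb{R}^2$ be the triangle with vertices $(0,0)$, $(0,1)$, $(1,0)$. For $n\in\mathbb{N}$ let $X_1,\ldots,X_n$ be independent random points uniformly distributed in $T$. The random convex chain $T_n$ is the convex hull of $X_1,\ldots,X_n$ together with $(0,1)$ and $(1,0)$. The random variable $f_0(T_n)$ is the number of vertices of $T_n$, where the two deterministic points $(0,1)$ and $(1,0)$ are not counted. Write $p_k^{(n)}:=\mathbb{P}(f_0(T_n)=k)$, $k=1,\ldots,n$. By a known result of Buchta (2006), $$p_k^{(n)}=2^k\sum_{i_1+\ldots+i_k=n}\frac{1}{i_1(i_1+i_2)\cdots(i_1+\ldots+i_k)}\cdot\frac{i_1\cdots i_k}{(i_1+1)(i_1+i_2+1)\cdots(i_1+\ldots+i_k+1)},$$ where the sum runs over all integers $i_1,\ldots,i_k\geq1$ with $i_1+\ldots+i_k=n$. *)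

(* Defs.v *)
From HB Require Import structures.
From mathcomp Require Export all_boot all_order all_algebra finmap.
From mathcomp Require Export all_classical all_reals all_analysis.

Set Implicit Arguments.
Unset Strict Implicit.
Unset Printing Implicit Defensive.

Import Order.TTheory GRing.Theory Num.Theory.
Import numFieldNormedType.Exports.

Local Open Scope classical_set_scope.
Local Open Scope ring_scope.

(* [R^2] with its Borel sigma-algebra (the product of the Borel
   sigma-algebras); as a real vector space the same carrier is [R^o * R^o]. *)
Notation plane R := (measurableTypeR R * measurableTypeR R)%type.

Definition convex_hull (R : realType) (A : set (plane R)) : set (plane R) :=
  smallest (@convex_set R (R^o * R^o)%type) A.

(* For a polygon these are its vertices. *)
Definition extreme_points (R : realType) (K : set (plane R)) : set (plane R) :=
  [set x | K x /\ forall (a b : R^o * R^o) (t : R), K a -> K b ->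
    0 < t < 1 -> x = t *: a + (1 - t) *: b -> a = x /\ b = x].

Lemma extreme_points_convex_hull (R : realType) (A : set (plane R)) :
  extreme_points (convex_hull A) `<=` A.
Proof.
move=> x [Kx xe]; apply: contrapT => nAx.
have H : convex_hull A `<=` [set y | convex_hull A y /\ y <> x].
  apply: smallest_sub; last first.
    move=> y Ay; split; first exact: sub_gen_smallest.
    by move=> yx; apply: nAx; rewrite -yx.
  apply/convex_setW => a b; rewrite !inE => -[Ka ax] [Kb bx] k k0 k1; rewrite inE.
  split.
    move=> C [cC AC]; have Ca : C a := Ka C (conj cC AC).
    have Cb : C b := Kb C (conj cC AC).
    apply/set_mem; apply: (cC a b k); rewrite inE; [exact: Ca|exact: Cb].
  move=> e; have [] := xe a b k%:num Ka Kb.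
  - by rewrite k0.
  - by rewrite -e.
  - by move=> /ax.
by have [] := H _ Kx.
Qed.

Definition triangle (R : realType) : set (plane R) :=
  convex_hull [set (0, 0); (0, 1); (1, 0)].

Arguments triangle : clear implicits.

Definition convex_chain (R : realType) (n : nat) (x : 'I_n -> plane R) :
    set (plane R) :=
  convex_hull (range x `|` [set (0, 1); (1, 0)]).

(* [fset_set] is faithful here: by [extreme_points_convex_hull] there are only
   finitely many extreme points. *)
Definition f0 (R : realType) (n : nat) (x : 'I_n -> plane R) : nat :=
  #|` fset_set (extreme_points (convex_chain x) `\` [set (0, 1); (1, 0)]) |%fset.

Definition mutually_independent (R : realType) (d d' : measure_display)
    (Omega : measurableType d) (S : measurableType d') (P : probability Omega R)
    (I : finType) (X : I -> {RV P >-> S}) : Prop :=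
  forall (J : {set I}) (A : I -> set S), (forall i, measurable (A i)) ->
    P (\bigcap_(i in [set` J]) X i @^-1` A i) =
    (\prod_(i in J) P (X i @^-1` A i))%E.

Definition uniform_in (R : realType) (d : measure_display)
    (Omega : measurableType d) (P : probability Omega R)
    (X : {RV P >-> plane R}) (K : set (plane R)) : Prop :=
  let area := (@lebesgue_measure R \x @lebesgue_measure R)%E in
  forall A : set (plane R), measurable A ->
    distribution P X A = (area (A `&` K) / area K)%E.

Definition chain_prob (R : realType) (d : measure_display)
    (Omega : measurableType d) (P : probability Omega R) (n : nat)
    (X : 'I_n -> {RV P >-> plane R}) (k : nat) : R :=
  fine (P [set w | f0 (fun i => X i w) = k]).

Definition chain_pgf (R : realType) (d : measure_display)
    (Omega : measurableType d) (P : probability Omega R) (n : nat)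
    (X : 'I_n -> {RV P >-> plane R}) (z : R) : R :=
  if n is 0 then 1 else \sum_(1 <= k < n.+1) chain_prob X k * z ^+ k.

Definition coef_a (R : realType) (n : nat) : R := 2 / (n%:R * (n%:R + 1)).

Definition coef_b (R : realType) (n : nat) : R := 2 * ((n%:R - 1) / (n%:R + 1)).

Definition coef_c (R : realType) (n : nat) : R :=
  (n%:R - 1) * (n%:R - 2) / (n%:R * (n%:R + 1)).

(* Main.v *)
(* Order the points by slope around a = (0, 1) and let V be the extreme one, that
   is, the vertex of the chain adjacent to a.  The line through a and V meets the
   first axis in Q; all other points lie in the triangle a Q c with c = (1, 0).
   Those above the line V c are not vertices, and the affine map sending a, (0, 0),
   c to V, Q, c turns those below it into independent uniform points of the
   original triangle, whose chain has one vertex less.  At V = (x, y) the two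
   subtriangles carry the masses 1 - x - y and y (1 - x - y) / (1 - y), so
   integrating over V (a beta integral) gives
     P(f_0(T_n) = k) = sum_(m < n) 2 (n - m) / (n (n + 1)) P(f_0(T_m) = k - 1),
   i.e. n (n + 1) G_n = 2 z sum_(m < n) (n - m) G_m, and taking second differences
   of both sides gives the three-term recurrence. *)

From HB Require Import structures.
From mathcomp Require Import fingroup perm measurable_realfun ring lra.
Require Import Defs.

Set Implicit Arguments.
Unset Strict Implicit.
Unset Printing Implicit Defensive.

Import Order.TTheory GRing.Theory Num.Theory.
Import numFieldNormedType.Exports.

Local Open Scope classical_set_scope.
Local Open Scope ring_scope.

(** * Convex hulls in the plane *)

(** Which sample point is adjacent to (0, 1) is random. The events that [X i] strictly leads are
    disjoint and, by exchangeability, equally likely, so the integral is computed with the first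
    point leading and multiplied by the sample size. The number of points left below V c is random
    too; functionals are therefore defined on sequences of every length, and independence enters as
    an iterated integral. For n other points, both masses at V share the factor 1 - x - y, so m
    points below and n - m above have mass C(n, m) (y / (1 - y))^m (1 - x - y)^n. Its integral over
    the triangle, times the density 2 and the n + 1 choices of V, is 2 (n + 1 - m) / ((n + 1) (n +
    2)): the weight of the overview with n + 1 in place of n. *)

Definition cmb (R : realType) (t : R) (a b : plane R) : plane R :=
  (t * a.1 + (1 - t) * b.1, t * a.2 + (1 - t) * b.2).

(** Trades the interval-typed coefficient for a real t, so that linear arithmetic applies. *)
Lemma convex_setP (R : realType) (A : set (plane R)) :
  @convex_set R (R^o * R^o)%type A <->
  forall (a b : plane R) (t : R), A a -> A b -> 0 < t < 1 -> A (cmb t a b).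
Proof.
split=> [cA a b t Aa Ab /andP[t0 t1]|cA].
  have t01 : Itv.spec (@Itv.num_sem R) (Itv.Real `[0%Z, 1%Z]) t.
    by rewrite /Itv.num_sem/= in_itv/= (ltW t0) (ltW t1) /= num_real.
  pose k : {i01 R} := Itv.mk t01.
  have := cA a b k; rewrite !inE => /(_ Aa Ab).
  by [].
apply/convex_setW => a b /set_mem Aa /set_mem Ab k k0 k1; rewrite inE.
by apply: (cA a b k%:num Aa Ab); rewrite k0.
Qed.

Lemma extreme_pointsP (R : realType) (K : set (plane R)) (x : plane R) :
  extreme_points K x <->
  K x /\ forall (a b : plane R) (t : R), K a -> K b -> 0 < t < 1 ->
    x = cmb t a b -> a = x /\ b = x.
Proof. by []. Qed.

Lemma sub_convex_hull (R : realType) (A : set (plane R)) : A `<=` convex_hull A.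
Proof. exact: sub_gen_smallest. Qed.

Lemma convex_hull_cmb (R : realType) (A : set (plane R)) a b t :
  convex_hull A a -> convex_hull A b -> 0 < t < 1 -> convex_hull A (cmb t a b).
Proof.
move=> Ka Kb t01 C [cC AC]; move/convex_setP: (cC); apply => //.
  exact: Ka.
exact: Kb.
Qed.

Lemma convex_hull_min (R : realType) (A C : set (plane R)) :
  (forall (a b : plane R) (t : R), C a -> C b -> 0 < t < 1 -> C (cmb t a b)) ->
  A `<=` C -> convex_hull A `<=` C.
Proof. by move=> cC AC; apply: smallest_sub => //; apply/convex_setP. Qed.

Lemma convex_hullS (R : realType) (A B : set (plane R)) :
  A `<=` B -> convex_hull A `<=` convex_hull B.
Proof.
move=> AB; apply: convex_hull_min; first exact: convex_hull_cmb.
exact: subset_trans AB (@sub_convex_hull _ _).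
Qed.

Lemma cmb0 (R : realType) (a b : plane R) : cmb 0 a b = b.
Proof. by rewrite [RHS]surjective_pairing; congr pair; ring. Qed.

Lemma cmb1 (R : realType) (a b : plane R) : cmb 1 a b = a.
Proof. by rewrite [RHS]surjective_pairing; congr pair; ring. Qed.

Lemma cmb_itv (R : realType) (A : set (plane R)) (p q : plane R) (t : R) :
  (forall (a b : plane R) (t : R), A a -> A b -> 0 < t < 1 -> A (cmb t a b)) ->
  A p -> A q -> 0 <= t <= 1 -> A (cmb t p q).
Proof.
move=> cA Ap Aq /andP[]; rewrite le_eqVlt => /predU1P[<- _|t0]; first by rewrite cmb0.
rewrite le_eqVlt => /predU1P[->|t1]; first by rewrite cmb1.
by apply: cA => //; rewrite t0.
Qed.

Section affine_image.
Variables (R : realType) (f : plane R -> plane R).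
Hypothesis f_cmb : forall t a b, f (cmb t a b) = cmb t (f a) (f b).
Hypothesis f_inj : injective f.

(** Both inclusions are minimality of the hull: the image of a hull is convex, and so is the
    preimage of one. *)
Lemma convex_hull_image (A : set (plane R)) :
  convex_hull (f @` A) = f @` convex_hull A.
Proof.
apply/seteqP; split.
  apply: convex_hull_min; last by apply: image_subset; exact: sub_convex_hull.
  move=> _ _ t [a Ka <-] [b Kb <-] t01; exists (cmb t a b) => //.
  exact: convex_hull_cmb.
move=> _ [p Kp <-].
apply: (@convex_hull_min _ A (f @^-1` convex_hull (f @` A))) Kp => /=.
  by move=> a b t fa fb t01 /=; rewrite f_cmb; exact: convex_hull_cmb.
by move=> x Ax /=; apply: sub_convex_hull; exists x.
Qed.

Lemma extreme_points_image (K : set (plane R)) :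
  extreme_points (f @` K) = f @` extreme_points K.
Proof.
apply/seteqP; split.
  move=> _ /extreme_pointsP [[x Kx <-] ext]; exists x => //.
  apply/extreme_pointsP; split=> // a b t Ka Kb t01 xE.
  have [||||/f_inj -> /f_inj ->//] := ext (f a) (f b) t.
  - by exists a.
  - by exists b.
  - exact: t01.
  - by rewrite xE f_cmb.
move=> _ [x /extreme_pointsP[Kx ext] <-]; apply/extreme_pointsP.
split; first by exists x.
move=> _ _ t [a Ka <-] [b Kb <-] t01; rewrite -f_cmb => /f_inj xE.
by have [-> ->] := ext a b t Ka Kb t01 xE.
Qed.
End affine_image.

Lemma extreme_points_sub (R : realType) (K L : set (plane R)) (x : plane R) :
  L `<=` K -> L x -> extreme_points K x -> extreme_points L x.
Proof.
move=> LK Lx [Kx ext]; split=> // a b t La Lb; exact: ext (LK _ La) (LK _ Lb).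
Qed.

(** * The vertex adjacent to (0, 1) *)

Definition open_triangle (R : realType) : set (plane R) :=
  [set p | [/\ 0 < p.1, 0 < p.2 & p.1 + p.2 < 1]].

(** Twice the signed area of the triangle (0, 1), V, W. For V in the open triangle it is positive on
    the side of (1, 0) of the line through (0, 1) and V. *)
Definition side_left (R : realType) (V W : plane R) : R :=
  (1 - V.2) * W.1 + V.1 * W.2 - V.1.

(** Again twice a signed area: zero on the line through V and (1, 0), positive on the side of the
    origin, where further vertices may lie. *)
Definition side_right (R : realType) (V W : plane R) : R :=
  V.2 * (1 - W.1) - (1 - V.1) * W.2.

Lemma side_left_cmb (R : realType) (V a b : plane R) (t : R) :
  side_left V (cmb t a b) = t * side_left V a + (1 - t) * side_left V b.
Proof. by rewrite /side_left /cmb /=; ring. Qed.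

Lemma side_right_cmb (R : realType) (V a b : plane R) (t : R) :
  side_right V (cmb t a b) = t * side_right V a + (1 - t) * side_right V b.
Proof. by rewrite /side_right /cmb /=; ring. Qed.

Section first_vertex.
Variables (R : realType) (V : plane R) (S : set (plane R)).
Hypothesis TV : open_triangle V.
Hypothesis TS : S `<=` open_triangle (R := R).
Hypothesis S_left : forall W, S W -> 0 < side_left V W.

Let a : plane R := (0, 1).
Let c : plane R := (1, 0).
Let B := S `&` [set W | 0 < side_right V W].
Let K := convex_hull (V |` S `|` [set a; c]).
Let K' := convex_hull (B `|` [set V; c]).

(** A relaxation of [K] by two linear inequalities. It is tight enough for [edge]: it meets the line
    V c exactly in the segment from V to c. *)
Let far (W : plane R) := 0 <= side_left V W /\ W.1 + W.2 <= 1.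

Let far_cmb (t : R) (p q : plane R) : far p -> far q -> 0 < t < 1 -> far (cmb t p q).
Proof.
move=> [lp sp] [lq sq] /andP[t0 t1]; split.
  by rewrite side_left_cmb; apply: addr_ge0; apply: mulr_ge0 => //; lra.
by rewrite /cmb/=; nra.
Qed.

Let gen_far W : (V |` S `|` [set a; c]) W -> far W.
Proof.
case: TV => V1 V2 V3.
move=> [[->|SW]|[->|->]]; rewrite /far.
- by rewrite /side_left; split; nra.
- by have [_ _ W3] := TS SW; split; apply: ltW => //; exact: S_left.
- by rewrite /side_left /=; split; nra.
- by rewrite /side_left /=; split; nra.
Qed.

Let K_far W : K W -> far W.
Proof.
move: W; apply: convex_hull_min; last exact: gen_far.
by move=> p q t; exact: far_cmb.
Qed.

Let K'_sub_K : K' `<=` K.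
Proof.
apply: convex_hullS => W [[SW _]|[->|->]]; first by left; right.
  by left; left.
by right; right.
Qed.

Let K'V : K' V. Proof. by apply: sub_convex_hull; right; left. Qed.
Let K'c : K' c. Proof. by apply: sub_convex_hull; right; right. Qed.

Let edge W : side_right V W = 0 -> far W -> K' W.
Proof.
case: TV => V1 V2 V3 W0 [lW sW].
have d0 : 0 < 1 - V.1 - V.2 by lra.
(* [1 - W.1 - W.2] is affine in W and vanishes at c, so on the line V c its ratio to the value at V
   is the weight of V. *)
pose t := (1 - W.1 - W.2) / (1 - V.1 - V.2).
have tE : t * (1 - V.1 - V.2) = 1 - W.1 - W.2 by rewrite divfK// gt_eqF.
(* The barycentric functionals of the triangle a V c add up to a constant; with [W0] this turns
   [0 <= side_left V W] into [t <= 1]. *)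
have lE : side_left V W = (1 - V.1 - V.2) - (1 - W.1 - W.2) + side_right V W.
  by rewrite /side_left /side_right; ring.
have -> : W = cmb t V c.
  rewrite [LHS]surjective_pairing; congr pair; apply: (mulIf (lt0r_neq0 d0)) => /=.
    have -> : (t * V.1 + (1 - t) * 1) * (1 - V.1 - V.2) =
      t * (1 - V.1 - V.2) * (V.1 - 1) + (1 - V.1 - V.2) by ring.
    by rewrite tE; move: W0; rewrite /side_right => W0; lra.
  rewrite mulr0 addr0 mulrAC tE.
  by move: W0; rewrite /side_right => W0; lra.
apply: cmb_itv => //; first exact: convex_hull_cmb.
by rewrite divr_ge0 ?(ltW d0) ?ler_pdivrMr//=; lra.
Qed.

(* A segment leaving [K'] towards the far side of the line [V c] crosses that
   line inside the edge [V c]. *)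
Let crossing (p q : plane R) (t : R) : K' p -> far q -> side_right V q <= 0 -> 0 < t < 1 ->
  0 < side_right V (cmb t p q) ->
  exists2 e, K' e & exists2 u : R, 0 < u < 1 & cmb t p q = cmb u p e /\
    side_right V e = 0.
Proof.
move=> Kp fq q0 /andP[t0 t1] pq0.
have p0 : 0 < side_right V p by move: pq0; rewrite side_right_cmb; nra.
pose x := side_right V p; pose y := side_right V q.
have xy : 0 < x - y by rewrite /x /y; lra.
(* [e] divides [p q] so that [x] and [y] balance. *)
pose v := - y / (x - y).
have vE : v * (x - y) = - y by rewrite divfK// gt_eqF.
have v0 : 0 <= v by rewrite divr_ge0 ?(ltW xy)// oppr_ge0.
have v1 : v < 1 by rewrite ltr_pdivrMr// mul1r /x; lra.
have tv : v < t.
  move: pq0; rewrite side_right_cmb -/x -/y => pq0.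
  by rewrite ltr_pdivrMr//; lra.
have e0 : side_right V (cmb v p q) = 0 by rewrite side_right_cmb -/x -/y; lra.
have fe : far (cmb v p q).
  apply: cmb_itv => //; first by move=> *; exact: far_cmb.
    by apply: K_far; exact: K'_sub_K.
  by rewrite v0 ltW.
exists (cmb v p q); first exact: edge.
have v10 : 0 < 1 - v by lra.
exists ((t - v) / (1 - v)).
  by rewrite divr_gt0 ?subr_gt0//= ltr_pdivrMr// mul1r; lra.
split=> //; congr pair => /=; field; lra.
Qed.

(** The right-hand side is convex: when a segment from [K'] to a point above V c is still below the
    line, [crossing] places it between its start and a point of the edge V c, both in [K']. *)
Let K_cover : K `<=` K' `|` [set W | side_right V W <= 0 /\ far W].
Proof.
apply: convex_hull_min; last first.
  move=> W gW; have fW := gen_far gW.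
  have [W0|W0] := lerP (side_right V W) 0; first by right.
  left; case: gW => [[->|SW]|[Wa|->]]; [exact: K'V| |exfalso|exact: K'c].
    by apply: sub_convex_hull; left.
  by move: W0; rewrite Wa /side_right /=; case: TV; lra.
have cov p q t : K' p -> side_right V q <= 0 -> far q -> 0 < t < 1 ->
  (K' `|` [set W | side_right V W <= 0 /\ far W]) (cmb t p q).
  move=> Kp q0 fq t01.
  have [pq0|pq0] := lerP (side_right V (cmb t p q)) 0.
    by right; split=> //; apply: far_cmb => //; apply: K_far; exact: K'_sub_K.
  have [e Ke [u u01 [-> _]]] := crossing Kp fq q0 t01 pq0.
  by left; exact: convex_hull_cmb.
move=> p q t [Kp|[p0 fp]] [Kq|[q0 fq]] t01.
- by left; exact: convex_hull_cmb.
- exact: cov.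
- have -> : cmb t p q = cmb (1 - t) q p by congr pair => /=; ring.
  by apply: cov => //; lra.
- right; split; last exact: far_cmb.
  by rewrite side_right_cmb; case/andP: t01; nra.
Qed.

(** Such a p lies strictly below V c. A segment of [K] through p that ends above the line can be cut
    off at V c by [crossing]; extremality in [K'] would then make p equal to a point of that
    line. *)
Let extK'_extK p : extreme_points K' p -> p <> V -> p <> c -> extreme_points K p.
Proof.
move=> extp pV pc.
have Bp : B p.
  by have [|[//|//]] := extreme_points_convex_hull extp.
have p0 : 0 < side_right V p by case: Bp.
case/extreme_pointsP: extp => Kp ext; apply/extreme_pointsP.
split; first exact: K'_sub_K.
have key u v t : K' u -> side_right V v <= 0 -> far v -> 0 < t < 1 ->
    p <> cmb t u v.
  move=> Ku v0 fv t01 pE.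
  have [|e Ke [x x01 [pE' e0]]] := crossing Ku fv v0 t01; first by rewrite -pE.
  have [_ ep] : u = p /\ e = p by apply: (ext _ _ x) => //; rewrite pE.
  by move: e0 p0; rewrite ep => ->; rewrite ltxx.
move=> u v t /K_cover[Ku|[u0 fu]] /K_cover[Kv|[v0 fv]] t01 pE.
- exact: ext t01 pE.
- by have := key u v t Ku v0 fv t01.
- exfalso; apply: (key v u (1 - t)) => //; first by lra.
  by rewrite pE; congr pair => /=; ring.
- by exfalso; move: p0; rewrite pE side_right_cmb; case/andP: t01; nra.
Qed.

(** A point of [S] on or above V c is a proper combination of c and a point of the edge a V, hence
    not extreme. Any other point is in [B], and extremality passes to the smaller set [K']. *)
Let extK_extK' p : extreme_points K p -> p <> V -> p <> a -> p <> c ->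
  extreme_points K' p.
Proof.
case: TV => V1 V2 V3.
move=> extp pV pa pc.
have Sp : S p.
  by have [[|]|[]] := extreme_points_convex_hull extp.
have [_ _ p3] := TS Sp.
have lp := S_left Sp.
have [p0|p0] := lerP (side_right V p) 0; last first.
  apply: extreme_points_sub extp => //.
  by apply: sub_convex_hull; left.
(* Barycentric coordinates of [p] with respect to [a], [V] and [c]. *)
pose d := 1 - V.1 - V.2.
have d0 : 0 < d by rewrite /d; lra.
pose w := side_left V p / d.
have wE : w * d = side_left V p by rewrite divfK// gt_eqF.
have lE : side_left V p = d - (1 - p.1 - p.2) + side_right V p.
  by rewrite /side_left /side_right /d; ring.
have w0 : 0 < w by rewrite divr_gt0.
have w1 : w < 1 by rewrite ltr_pdivrMr// mul1r; lra.
pose y := (1 - p.1 - p.2) / d.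
have yE : y * d = 1 - p.1 - p.2 by rewrite divfK// gt_eqF.
have y0 : 0 < y by rewrite divr_gt0//; lra.
have yw : y <= 1 - w by rewrite ler_pdivrMr// mulrBl mul1r; lra.
pose m := cmb (y / (1 - w)) V a.
have Km : K m.
  apply: cmb_itv; first exact: convex_hull_cmb.
  - by apply: sub_convex_hull; left; left.
  - by apply: sub_convex_hull; right; left.
  - by rewrite divr_ge0 ?ler_pdivrMr ?mul1r//=; lra.
have Kc : K c by apply: sub_convex_hull; right; right.
have pE : p = cmb w c m.
  have w10 : 1 - w != 0 by rewrite gt_eqF//; lra.
  have zE : (1 - w) * (y / (1 - w)) = y by rewrite mulrC divfK.
  rewrite [LHS]surjective_pairing; congr pair; apply: (mulIf (lt0r_neq0 d0)) => /=.
    have -> : (w * 1 + (1 - w) * (y / (1 - w) * V.1 + (1 - y / (1 - w)) * 0)) * d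
      = w * d + (1 - w) * (y / (1 - w)) * d * V.1 by ring.
    by rewrite zE wE yE /side_left /d; ring.
  have -> : (w * 0 + (1 - w) * (y / (1 - w) * V.2 + (1 - y / (1 - w)) * 1)) * d
      = (1 - w) * (y / (1 - w)) * d * (V.2 - 1) + d - w * d by ring.
  by rewrite zE wE yE /side_left /d; ring.
case/extreme_pointsP: extp => _ /(_ c m w Kc Km) [].
- by rewrite w0.
- exact: pE.
- by move=> cp _; rewrite cp in pc.
Qed.

(* The lexicographic half-plane bounded by the line through [a] and [V] contains
   [K] and has [V] as its least point. *)
Let extK_V : extreme_points K V.
Proof.
case: TV => V1 V2 V3.
pose L := [set W : plane R | 0 < side_left V W \/
  side_left V W = 0 /\ V.2 <= W.2].
have KL : K `<=` L.
  apply: convex_hull_min.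
    move=> p q t; rewrite /L /= side_left_cmb.
    by move=> [p0|[p0 pV]] [q0|[q0 qV]] /andP[t0 t1];
      [left; nra|left; nra|left; nra|right; rewrite p0 q0; split; nra].
  move=> W [[->|/S_left]|[->|->]]; rewrite /L/=; [right| by left| right| left];
    rewrite /side_left/=; try split; lra.
apply/extreme_pointsP; split; first by apply: sub_convex_hull; left; left.
move=> u v t /KL Lu /KL Lv /andP[t0 t1] VE.
have l0 : 0 = t * side_left V u + (1 - t) * side_left V v.
  by rewrite -side_left_cmb -VE /side_left; ring.
have V2E : V.2 = t * u.2 + (1 - t) * v.2 by rewrite {1}VE.
have [lu uV] : side_left V u = 0 /\ V.2 <= u.2.
  by case: Lu Lv => [lu|//] [lv|[lv _]]; nra.
have [lv vV] : side_left V v = 0 /\ V.2 <= v.2.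
  by case: Lv => [lv|//]; nra.
have uE : u.2 = V.2 by nra.
have vE : v.2 = V.2 by nra.
have V20 : 1 - V.2 != 0 by rewrite gt_eqF//; lra.
split; rewrite [LHS]surjective_pairing [RHS]surjective_pairing; congr pair => //;
  apply: (mulfI V20).
  by move: lu; rewrite /side_left uE; lra.
by move: lv; rewrite /side_left vE; lra.
Qed.

(** The hull on the right is again chain-like, with V in the role of (0, 1); this is what an affine
    map can carry back to the original triangle. *)
Lemma extreme_points_first_vertex :
  extreme_points (convex_hull (V |` S `|` [set (0, 1); (1, 0)])) `\`
    [set (0, 1); (1, 0)] =
  V |` (extreme_points (convex_hull ((S `&` [set W | 0 < side_right V W])
    `|` [set V; (1, 0)])) `\` [set V; (1, 0)]).
Proof.
case: TV => V1 V2 V3.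
apply/seteqP; split=> p.
  move=> [extp /not_orP[pa pc]].
  have [->|/eqP pV] := eqVneq p V; first by left.
  by right; split; [exact: extK_extK'|move=> []].
case=> [->|[extp /not_orP[pV pc]]].
  by split; [exact: extK_V|move=> [VE|VE]; move: V1 V2; rewrite VE /= ltxx].
split; first exact: extK'_extK.
have [Bp|[//|//]] := extreme_points_convex_hull extp.
by case: Bp => /TS [p1 p2 _] _ [pE|pE]; move: p1 p2; rewrite pE /= ltxx.
Qed.

End first_vertex.

(** * Rescaling the remaining chain to the original triangle *)

Definition chain_vertices (R : realType) (S : set (plane R)) : set (plane R) :=
  extreme_points (convex_hull (S `|` [set (0, 1); (1, 0)])) `\` [set (0, 1); (1, 0)].

Lemma chain_vertices_sub (R : realType) (S : set (plane R)) :
  chain_vertices S `<=` S.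
Proof. by move=> p [/extreme_points_convex_hull[]]. Qed.

(** On sequences rather than indexed families, because the reduction changes the number of
    points. *)
Definition count_vertices (R : realType) (s : seq (plane R)) : nat :=
  #|` fset_set (chain_vertices [set` s])|%fset.

Lemma f0E (R : realType) (n : nat) (x : 'I_n -> plane R) :
  f0 x = count_vertices (codom x).
Proof.
rewrite /f0 /convex_chain /count_vertices /chain_vertices.
suff -> : range x = [set` codom x] by [].
by apply/seteqP; split=> [_ [i _ <-]|_ /codomP[i ->]] /=; [exact: codom_f|exists i].
Qed.

(* The affine map fixing [(1, 0)] that sends [(0, 1)] to [V] and [(0, 0)] to the
   point where the line from [(0, 1)] through [V] meets the first axis. *)
Definition corner (R : realType) (V p : plane R) : plane R :=
  (V.1 / (1 - V.2) + p.1 * (1 - V.1 / (1 - V.2)) + p.2 * (V.1 - V.1 / (1 - V.2)),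
   p.2 * V.2).

(** Each coordinate is a normalised affine function: [side_left V] vanishes at the images of (0, 1)
    and (0, 0) and equals the denominator at (1, 0); [W.2] vanishes on the first axis. *)
Definition corner_inv (R : realType) (V W : plane R) : plane R :=
  (side_left V W / (1 - V.1 - V.2), W.2 / V.2).

Section corner.
Variables (R : realType) (V : plane R).
Hypothesis TV : open_triangle V.

Lemma cornerK : cancel (corner V) (corner_inv V).
Proof.
case: TV => V1 V2 V3 p; rewrite [RHS]surjective_pairing; congr pair => /=.
  by rewrite /side_left /corner /=; field; rewrite !gt_eqF//; lra.
by rewrite mulfK// gt_eqF.
Qed.

Lemma corner_invK : cancel (corner_inv V) (corner V).
Proof.
case: TV => V1 V2 V3 p; rewrite [RHS]surjective_pairing; congr pair => /=.
  by rewrite /side_left; field; rewrite !gt_eqF//; lra.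
by rewrite divfK// gt_eqF.
Qed.

Lemma corner_cmb t a b : corner V (cmb t a b) = cmb t (corner V a) (corner V b).
Proof. by congr pair => /=; ring. Qed.

Lemma corner01 : corner V (0, 1) = V.
Proof. by rewrite [RHS]surjective_pairing; congr pair => /=; ring. Qed.

Lemma corner10 : corner V (1, 0) = (1, 0).
Proof. by congr pair => /=; ring. Qed.

Lemma count_vertices_cons (s : seq (plane R)) :
  (forall W, W \in s -> open_triangle W) ->
  (forall W, W \in s -> 0 < side_left V W) ->
  count_vertices (V :: s) =
  (count_vertices (map (corner_inv V) [seq W <- s | 0 < side_right V W])).+1.
Proof.
move=> Ts Ls.
pose B : set (plane R) := [set` [seq W <- s | 0 < side_right V W]].
pose s' := map (corner_inv V) [seq W <- s | 0 < side_right V W].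
have corner_inj : injective (corner V) := can_inj cornerK.
have BE : corner V @` [set` s'] = B.
  apply/seteqP; split.
    by move=> _ [_ /mapP[W Ws ->] <-]; rewrite corner_invK.
  by move=> W BW; exists (corner_inv V W); [exact: map_f|exact: corner_invK].
have imE : corner V @` ([set` s'] `|` [set (0, 1); (1, 0)]) = B `|` [set V; (1, 0)].
  by rewrite !image_setU BE !image_set1 corner01 corner10.
have vE : chain_vertices [set` V :: s] = V |` (corner V @` chain_vertices [set` s']).
  rewrite /chain_vertices.
  have -> : [set` V :: s] = V |` [set` s].
    apply/seteqP; split=> W /=; rewrite inE.
      by move=> /orP[/eqP ->|]; [left|right].
    by move=> [->|->]; rewrite ?eqxx ?orbT.
  rewrite extreme_points_first_vertex//; congr (_ `|` _).
  have -> : [set` s] `&` [set W | 0 < side_right V W] = B.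
    apply/seteqP; split=> W; rewrite /B /= mem_filter.
      by move=> [-> ->].
    by move=> /andP[].
  rewrite -imE convex_hull_image//; last exact: corner_cmb.
  rewrite extreme_points_image//; last exact: corner_cmb.
  have -> : [set V; (1, 0)] = corner V @` [set (0, 1); (1, 0)].
    by rewrite image_setU !image_set1 corner01 corner10.
  apply/seteqP; split.
    by move=> _ [[p ep <-] np]; exists p => //; split=> // np'; apply: np; exists p.
  move=> _ [p [ep np] <-]; split; first by exists p.
  by move=> [q nq /corner_inj qp]; apply: np; rewrite -qp.
have fin (l : seq (plane R)) : finite_set (chain_vertices [set` l]).
  exact: sub_finite_set (@chain_vertices_sub _ _) (finite_seq l).
rewrite /count_vertices vE fset_setU1; last exact: finite_image.
rewrite fset_set_image// cardfsU1 card_imfset//= -/s'.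
(* V adds one to the count: [side_right V V] is 0, so V is not in [B], the image of [s']. *)
suff -> : (V \notin [fset corner V x | x in fset_set (chain_vertices [set` s'])])%fset.
  by [].
apply/negP => /imfsetP[p /=]; rewrite in_fset_set// inE => /chain_vertices_sub /= ps' VE.
have : B V by rewrite -BE; exists p.
by rewrite /B /= mem_filter => /andP[+ _]; rewrite /side_right; lra.
Qed.

End corner.

(** * Measurability of the number of vertices *)

Definition cross (R : realType) (p q r : plane R) : R :=
  (q.1 - p.1) * (r.2 - p.2) - (q.2 - p.2) * (r.1 - p.1).

Definition dot (R : realType) (p q r : plane R) : R :=
  (q.1 - p.1) * (r.1 - p.1) + (q.2 - p.2) * (r.2 - p.2).

(* [r] lies at an angle in [0, pi) counterclockwise from [q], as seen from [p] *)
Definition ccw (R : realType) (p q r : plane R) : bool :=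
  (0 < cross p q r) || (cross p q r == 0) && (0 < dot p q r).

(* The pivot criterion consists of finitely many polynomial inequalities, which
   makes the number of vertices measurable. *)
Section pivot.
Variables (R : realType) (p : plane R).
Let K (s : seq (plane R)) := convex_hull [set` p :: s].

Let cross_cmb q t a b : cross p q (cmb t a b) = t * cross p q a + (1 - t) * cross p q b.
Proof. by rewrite /cross /=; ring. Qed.

Let dot_cmb q t a b : dot p q (cmb t a b) = t * dot p q a + (1 - t) * dot p q b.
Proof. by rewrite /dot /=; ring. Qed.

Let dot_gt0 q : q != p -> 0 < dot p q q.
Proof.
move=> qp; have q0 : (q.1 - p.1 != 0) || (q.2 - p.2 != 0).
  rewrite -negb_and; apply: contra qp => /andP[].
  rewrite !subr_eq0 => /eqP q1 /eqP q2.
  by apply/eqP; rewrite [LHS]surjective_pairing [RHS]surjective_pairing q1 q2.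
rewrite /dot -!expr2.
by case/orP: q0 => q0; [apply: ltr_wpDr|apply: ltr_wpDl];
  rewrite ?sqr_ge0// exprn_even_gt0.
Qed.

(** Ordered lexicographically by cross and dot product, [L] contains the hull and has p as its only
    least point, which cannot be interior to a proper segment. *)
Lemma extreme_points_pivot (s : seq (plane R)) (q : plane R) :
  q != p -> all (fun r => (r == p) || ccw p q r) s -> extreme_points (K s) p.
Proof.
move=> qp /allP sq.
pose L := [set r : plane R | 0 < cross p q r \/ cross p q r = 0 /\ 0 <= dot p q r].
have KL : K s `<=` L.
  apply: convex_hull_min.
    move=> a b t; rewrite /L /= cross_cmb dot_cmb.
    by move=> [a0|[a0 aV]] [b0|[b0 bV]] /andP[t0 t1];
      [left; nra|left; nra|left; nra|right; rewrite a0 b0; split; nra].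
  move=> r /=; rewrite inE => /predU1P[->|/sq /predU1P[->|]]; rewrite /L /=.
  - by right; rewrite /cross /dot; split; nra.
  - by right; rewrite /cross /dot; split; nra.
  - by move=> /orP[|/andP[/eqP -> /ltW]]; [left|right].
split; first by apply: sub_convex_hull; rewrite /= mem_head.
move=> a b t /KL La /KL Lb /andP[t0 t1] pE.
have {}pE : p = cmb t a b by [].
have c0 : 0 = t * cross p q a + (1 - t) * cross p q b.
  by rewrite -cross_cmb -pE /cross; ring.
have d0 : 0 = t * dot p q a + (1 - t) * dot p q b.
  by rewrite -dot_cmb -pE /dot; ring.
have [la da] : cross p q a = 0 /\ 0 <= dot p q a.
  by case: La Lb => [la|//] [lb|[lb _]]; nra.
have [lb db] : cross p q b = 0 /\ 0 <= dot p q b.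
  by case: Lb => [lb|//]; nra.
have da0 : dot p q a = 0 by nra.
have db0 : dot p q b = 0 by nra.
have n0 := dot_gt0 qp.
(* Cross and dot product are the coordinates of r - p in the orthogonal frame of q - p; scaling by
   [dot p q q] recovers its components. *)
have eq0 r : cross p q r = 0 -> dot p q r = 0 -> r = p.
  move=> cr dr; rewrite [LHS]surjective_pairing [RHS]surjective_pairing.
  congr pair; apply/eqP; rewrite -subr_eq0 -(mulrI_eq0 _ (mulfI (lt0r_neq0 n0))); apply/eqP.
    transitivity ((q.1 - p.1) * dot p q r - (q.2 - p.2) * cross p q r).
      by rewrite /dot /cross; ring.
    by rewrite cr dr; ring.
  transitivity ((q.1 - p.1) * cross p q r + (q.2 - p.2) * dot p q r).
    by rewrite /dot /cross; ring.
  by rewrite cr dr; ring.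
by split; apply: eq0.
Qed.

(** Induction on [s], keeping the clockwise-most direction q. A new point d that is not
    counterclockwise of q becomes the pivot; an old r not counterclockwise of d would put p in the
    triangle q d r, against extremality. *)
Lemma pivot_extreme_points (s : seq (plane R)) : extreme_points (K s) p ->
  all (pred1 p) s \/
  exists2 q, q \in s & (q != p) && all (fun r => (r == p) || ccw p q r) s.
Proof.
elim: s => [|d s IH] extp; first by left.
have Kd r : r \in p :: d :: s -> K (d :: s) r by move=> rs; apply: sub_convex_hull.
have sub : K s `<=` K (d :: s).
  by apply: convex_hullS => r /=; rewrite !inE => /orP[->//|->]; rewrite !orbT.
have Kp : K s p by apply: sub_convex_hull; rewrite /= mem_head.
have [sp|[q qs /andP[qp sq]]] := IH (extreme_points_sub sub Kp extp).
  have [dp|dp] := eqVneq d p; first by left; rewrite /= dp eqxx.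
  right; exists d; rewrite ?mem_head// dp /= (negPf dp) /=.
  apply/andP; split.
    by rewrite /ccw dot_gt0// andbT (_ : cross p d d = 0) ?eqxx ?orbT// /cross; ring.
  by apply/allP => r /(allP sp) /= ->.
have qdp : q \in p :: d :: s by rewrite !inE qs !orbT.
have ddp : d \in p :: d :: s by rewrite !inE eqxx !orbT.
have [dp|dp] := eqVneq d p; first by right; exists q; rewrite ?inE ?qs ?orbT//= dp eqxx qp.
have [qd|] := boolP (ccw p q d).
  by right; exists q; rewrite ?inE ?qs ?orbT//= qd orbT qp.
(* Under extremality the failure of [ccw] is strict: a zero cross product with a nonpositive dot
   product would put p inside the segment from x to y. *)
have opp x y : x \in p :: d :: s -> y \in p :: d :: s -> x != p -> y != p ->
    ~~ ccw p x y -> cross p x y < 0.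
  move=> xs ys xp yp; rewrite /ccw negb_or -leNgt le_eqVlt => /andP[/orP[/eqP c0|//]].
  rewrite c0 eqxx /= -leNgt => d0; exfalso.
  have x0 := dot_gt0 xp; have y0 := dot_gt0 yp.
  have yE1 : dot p x x * (y.1 - p.1) = dot p x y * (x.1 - p.1).
    transitivity (dot p x y * (x.1 - p.1) - cross p x y * (x.2 - p.2)).
      by rewrite /dot /cross; ring.
    by rewrite c0; ring.
  have yE2 : dot p x x * (y.2 - p.2) = dot p x y * (x.2 - p.2).
    transitivity (dot p x y * (x.2 - p.2) + cross p x y * (x.1 - p.1)).
      by rewrite /dot /cross; ring.
    by rewrite c0; ring.
  have d1 : dot p x y < 0.
    have : dot p x y * dot p x y = dot p x x * dot p y y.
      transitivity (dot p x x * dot p y y - cross p x y ^+ 2).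
        by rewrite /dot /cross; ring.
      by rewrite c0; ring.
    by have := mulr_gt0 x0 y0; nra.
  (* Since y - p is [dot p x y / dot p x x] times x - p, the weights of x and y at p are
     proportional to [- dot p x y] and [dot p x x]. *)
  have u0 : 0 < dot p x x - dot p x y by lra.
  case/extreme_pointsP: extp => _
    /(_ x y (- dot p x y / (dot p x x - dot p x y)) (Kd _ xs) (Kd _ ys)) [].
  - by rewrite divr_gt0 ?oppr_gt0//= ltr_pdivrMr//; lra.
  - rewrite [LHS]surjective_pairing; congr pair; apply: (mulIf (lt0r_neq0 u0)).
      rewrite mulrDl mulrAC divfK ?gt_eqF// mulrAC mulrBl divfK ?gt_eqF//; lra.
    rewrite mulrDl mulrAC divfK ?gt_eqF// mulrAC mulrBl divfK ?gt_eqF//; lra.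
  - by move=> xp'; rewrite xp' eqxx in xp.
move=> /(opp _ _ qdp ddp qp dp) qd; right; exists d; rewrite ?mem_head// dp /= (negPf dp) /=.
rewrite /ccw dot_gt0// andbT (_ : cross p d d = 0) ?eqxx ?orbT/=; last by rewrite /cross; ring.
apply/allP => r rs; have [//|rp /=] := eqVneq r p.
have := allP sq r rs; rewrite (negPf rp) /= => qr.
apply/negPn/negP; rewrite -/(ccw p d r) => dr.
have rdp : r \in p :: d :: s by rewrite !inE rs !orbT.
have {}dr := opp _ _ ddp rdp dp rp dr.
have {}qr : 0 <= cross p q r by case/orP: qr => [/ltW//|/andP[/eqP -> _]].
(* [p] is in the triangle [q d r], with these signed areas as weights. *)
pose x := - cross p d r; pose y := cross p q r; pose z := - cross p q d.
have x0 : 0 < x by rewrite oppr_gt0.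
have z0 : 0 < z by rewrite oppr_gt0.
have y0 : 0 <= y by [].
have xy0 : x + y != 0 by rewrite gt_eqF//; lra.
have xyz0 : z + (x + y) != 0 by rewrite gt_eqF//; lra.
have Km : K (d :: s) (cmb (x / (x + y)) q d).
  apply: cmb_itv; [exact: convex_hull_cmb|exact: Kd|exact: Kd|].
  by rewrite divr_ge0/= ?ler_pdivrMr; lra.
case/extreme_pointsP: extp => _ /(_ r _ (z / (z + (x + y))) (Kd _ rdp) Km) [].
- by rewrite divr_gt0 ?ltr_pdivrMr//=; lra.
- have zE : (1 - z / (z + (x + y))) * (z + (x + y)) = x + y by rewrite mulrBl divfK//; ring.
  have xE : (x / (x + y)) * (x + y) = x by rewrite divfK.
  have mE A B : (1 - z / (z + (x + y))) * (x / (x + y) * A + (1 - x / (x + y)) * B) *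
      (z + (x + y)) = x * A + y * B.
    rewrite mulrAC zE.
    transitivity (x / (x + y) * (x + y) * A + ((x + y) - x / (x + y) * (x + y)) * B).
      by ring.
    by rewrite xE; ring.
  rewrite [LHS]surjective_pairing; congr pair; apply: (mulIf xyz0);
    by rewrite /= mulrDl mE mulrAC divfK// /x /y /z /cross; ring.
- by move=> rp'; rewrite rp' eqxx in rp.
Qed.
End pivot.

Definition is_vertex (R : realType) (s : seq (plane R)) (p : plane R) : bool :=
  let s' := s ++ [:: (0, 1); (1, 0)] in
  [&& p != (0, 1), p != (1, 0) &
    has (fun q => (q != p) && all (fun r => (r == p) || ccw p q r) s') s'].

(** The pivot criterion applied with both base points in the list; as these differ, the degenerate
    case of a list constantly p cannot occur. *)
Lemma chain_verticesP (R : realType) (s : seq (plane R)) (p : plane R) :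
  p \in s -> chain_vertices [set` s] p <-> is_vertex s p.
Proof.
move=> ps; set s' := s ++ [:: (0, 1); (1, 0)].
have sE : [set` s] `|` [set (0, 1); (1, 0)] = [set` p :: s'].
  apply/seteqP; split=> q /=; rewrite inE mem_cat !inE.
    by move=> [->|[->|->]]; rewrite ?eqxx ?orbT.
  move=> /orP[/eqP ->|/orP[->|/orP[/eqP ->|/eqP ->]]];
    [by left|by left|by right; left|by right; right].
rewrite /chain_vertices /is_vertex sE; split.
  move=> [/pivot_extreme_points + /not_orP[/eqP -> /eqP ->]] /=.
  move=> [/allP sp|[q qs qP]]; last by apply/hasP; exists q.
  have /eqP p1 : (0, 1) == p by apply: sp; rewrite mem_cat !inE eqxx orbT.
  have /eqP : (1, 0) == p by apply: sp; rewrite mem_cat !inE eqxx !orbT.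
  by rewrite -p1 => -[/eqP]; rewrite oner_eq0.
move=> /and3P[/eqP pa /eqP pc /hasP[q _ /andP[qp sq]]].
by split; [exact: extreme_points_pivot sq|move=> []].
Qed.

(** Sample points may coincide, so each vertex is charged to its least index; [f0] becomes a sum of
    indicators. *)
Definition is_fresh_vertex (R : realType) (n : nat) (x : 'I_n -> plane R) (i : 'I_n) :=
  is_vertex (codom x) (x i) && all (fun j : 'I_n => (j < i)%N ==> (x j != x i)) (enum 'I_n).

Lemma f0_sum (R : realType) (n : nat) (x : 'I_n -> plane R) :
  f0 x = (\sum_(i < n) is_fresh_vertex x i)%N.
Proof.
rewrite f0E /count_vertices.
pose I := [fset i in [seq i <- enum 'I_n | is_fresh_vertex x i]]%fset.
have inI i : (i \in I) = is_fresh_vertex x i by rewrite !inE mem_filter mem_enum andbT.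
have -> : fset_set (chain_vertices [set` codom x]) = [fset x i | i in I]%fset.
  apply/fsetP => p; rewrite in_fset_set; last first.
    exact: sub_finite_set (@chain_vertices_sub _ _) (finite_seq _).
  apply/idP/imfsetP => /=.
    rewrite inE => vp; have /= /codomP[i0 pE] := chain_vertices_sub vp.
    have := chain_verticesP (chain_vertices_sub vp : p \in codom x).
    move=> [/(_ vp) pv _].
    have ex : exists k, [exists i : 'I_n, (i == k :> nat) && (x i == p)].
      by exists i0; apply/existsP; exists i0; rewrite eqxx pE eqxx.
    case: (ex_minnP ex) => k /existsP[i /andP[/eqP ik /eqP xi]] kmin.
    exists i => //; rewrite /= inI /is_fresh_vertex xi pv /=.
    apply/allP => j _; apply/implyP; rewrite ltnNge; apply: contra => /eqP xj.
    by rewrite ik; apply: kmin; apply/existsP; exists j; rewrite xj !eqxx.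
  move=> [i Ii ->]; rewrite inE; apply/chain_verticesP; first exact: codom_f.
  by move: Ii; rewrite /= inI => /andP[].
rewrite card_in_imfset; last first.
  move=> i j; rewrite /= !inI => /andP[_ /allP fi] /andP[_ /allP fj] xij.
  apply/val_inj; apply/eqP; rewrite eqn_leq; apply/andP; split; rewrite leqNgt; apply/negP => ij.
    by have := fi j (mem_enum _ _); rewrite ij xij eqxx.
  by have := fj i (mem_enum _ _); rewrite ij xij eqxx.
transitivity (size (undup [seq i <- enum 'I_n | is_fresh_vertex x i])).
  exact: card_fseq.
rewrite undup_id; last by rewrite filter_uniq ?enum_uniq.
rewrite size_filter -sum1_count.
by rewrite big_enum_cond big_mkcond /=; apply: eq_bigr => i _; case: is_fresh_vertex.
Qed.

Lemma measurable_all d (T : measurableType d) (I : Type) (s : seq I) (F : I -> T -> bool) :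
  (forall i, measurable_fun setT (F i)) ->
  measurable_fun setT (fun w => all (F^~ w) s).
Proof.
move=> mF; elim: s => [|i s IH] /=; first exact: measurable_cst.
exact: measurable_and.
Qed.

Lemma measurable_has d (T : measurableType d) (I : Type) (s : seq I) (F : I -> T -> bool) :
  (forall i, measurable_fun setT (F i)) ->
  measurable_fun setT (fun w => has (F^~ w) s).
Proof.
move=> mF; elim: s => [|i s IH] /=; first exact: measurable_cst.
exact: measurable_or.
Qed.

Section f0_measurable.
Context (R : realType) d (T : measurableType d).
Implicit Types f g h : T -> plane R.

Lemma measurable_eq_plane f g : measurable_fun setT f -> measurable_fun setT g ->
  measurable_fun setT (fun w => f w == g w).
Proof.
move=> mf mg.
by apply: measurable_and; apply: measurable_fun_eqr; apply: measurableT_comp.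
Qed.

Let coord1 f : measurable_fun setT f -> measurable_fun setT (fun w => (f w).1 : measurableTypeR R).
Proof. by move=> mf; apply: (measurableT_comp measurable_fst). Qed.

Let coord2 f : measurable_fun setT f -> measurable_fun setT (fun w => (f w).2 : measurableTypeR R).
Proof. by move=> mf; apply: (measurableT_comp measurable_snd). Qed.

Lemma measurable_ccw f g h : measurable_fun setT f -> measurable_fun setT g ->
  measurable_fun setT h -> measurable_fun setT (fun w => ccw (f w) (g w) (h w)).
Proof.
move=> mf mg mh.
have m1 := coord1 mf; have m2 := coord2 mf; have m3 := coord1 mg; have m4 := coord2 mg.
have m5 := coord1 mh; have m6 := coord2 mh.
have mc : measurable_fun setT (fun w => cross (f w) (g w) (h w)).
  by apply: measurable_funB; apply: measurable_funM; apply: measurable_funB.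
have md : measurable_fun setT (fun w => dot (f w) (g w) (h w)).
  by apply: measurable_funD; apply: measurable_funM; apply: measurable_funB.
apply: measurable_or; first exact: measurable_fun_ltr.
by apply: measurable_and; [exact: measurable_fun_eqr|exact: measurable_fun_ltr].
Qed.

Lemma measurable_f0 (n : nat) (X : 'I_n -> T -> plane R) (k : nat) :
  (forall i, measurable_fun setT (X i)) -> measurable [set w | f0 (X^~ w) = k].
Proof.
move=> mX.
have mv i : measurable_fun setT (fun w => is_fresh_vertex (X^~ w) i).
  apply: measurable_and; last first.
    apply: measurable_all => j; have [ji|ji] := boolP (j < i)%N; last exact: measurable_cst.
    by apply: measurable_neg; exact: measurable_eq_plane.
  (* One index type for the sample and the two base points: [has] and [all] then run over a list
     that does not depend on w. *)
  pose Y (o : option (option 'I_n)) w : plane R :=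
    match o with Some (Some j) => X j w | Some None => (0, 1) | None => (1, 0) end.
  have mY o : measurable_fun setT (Y o) by
    case: o => [[j|]|]; [exact: mX|exact: measurable_cst|exact: measurable_cst].
  have YE w : codom (X^~ w) ++ [:: (0, 1); (1, 0)] =
      map (Y^~ w) (map (Some \o Some) (enum 'I_n) ++ [:: Some None; None]).
    by rewrite map_cat -map_comp.
  rewrite /is_vertex.
  apply: measurable_and; first by apply: measurable_neg; apply: measurable_eq_plane.
  apply: measurable_and; first by apply: measurable_neg; apply: measurable_eq_plane.
  under eq_fun do rewrite YE has_map.
  apply: measurable_has => o; apply: measurable_and => /=.
    by apply: measurable_neg; apply: measurable_eq_plane.
  under eq_fun do rewrite all_map.
  apply: measurable_all => o'; apply: measurable_or => /=.
    exact: measurable_eq_plane.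
  exact: measurable_ccw.
have ms : measurable_fun setT (fun w => \sum_(i < n) (is_fresh_vertex (X^~ w) i)%:R : R).
  apply: measurable_sum => i.
  rewrite (_ : (fun _ => _) = fun w => if is_fresh_vertex (X^~ w) i then 1 else 0).
    by apply: (measurable_fun_ifT (mv i)); exact: measurable_cst.
  by apply/funext => w; case: is_fresh_vertex.
have -> : [set w | f0 (X^~ w) = k] =
    (fun w => \sum_(i < n) (is_fresh_vertex (X^~ w) i)%:R : R) @^-1` [set k%:R].
  apply/seteqP; split=> w /=; rewrite f0_sum -natr_sum.
    by move=> ->.
  by move=> /eqP; rewrite eqr_nat => /eqP.
by rewrite -[X in measurable X]setTI; apply: ms => //; exact: measurable_set1.
Qed.

End f0_measurable.

(** * Iterated integrals and independent samples *)

Section iterated_integral.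
Context (R : realType) d (T : measurableType d).

(** Expectation over n independent draws from [mu], as a recursion so that one functional [h] serves
    all lengths. *)
Fixpoint iint (mu : set T -> \bar R) (n : nat) (h : seq T -> \bar R) : \bar R :=
  if n is n'.+1 then (\int[mu]_x iint mu n' (fun s => h (x :: s)))%E else h [::].

Variable mu : probability T R.
Local Open Scope ereal_scope.

Lemma iint_eq n (h g : seq T -> \bar R) :
  (forall s, size s = n -> h s = g s) -> iint mu n h = iint mu n g.
Proof.
elim: n h g => [|n IH] h g hg /=; first exact: hg.
by apply: eq_integral => x _; apply: IH => s sn; apply: hg; rewrite /= sn.
Qed.

Lemma iint_ge0 n (h : seq T -> \bar R) : (forall s, 0 <= h s) -> 0 <= iint mu n h.
Proof.
elim: n h => [|n IH] h h0 /=; first exact: h0.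
by apply: integral_ge0 => x _; exact: IH.
Qed.

Let consf n (p : T * n.-tuple T) : n.+1.-tuple T := [the n.+1.-tuple T of p.1 :: p.2].

Let measurable_consf n : measurable_fun setT (@consf n).
Proof. by apply: (@measurable_cons _ _ (T * n.-tuple T)%type _ fst n snd). Qed.

Lemma measurable_cons_section n (h : seq T -> \bar R) (x : T) :
  measurable_fun [set: n.+1.-tuple T] (h \o val) ->
  measurable_fun [set: n.-tuple T] ((fun s => h (x :: s)) \o val).
Proof.
move=> mh; apply: (measurableT_comp (g := @consf n \o pair x) mh).
apply: measurableT_comp; first exact: measurable_consf.
exact: pair1_measurable.
Qed.

(** Pushing products forward along cons realises the iterated integral by a measure on tuples, to
    which Tonelli and uniqueness of measures apply. *)
Lemma iint_tuple n : exists nu : probability (n.-tuple T) R,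
  forall h : seq T -> \bar R, measurable_fun [set: n.-tuple T] (h \o val) ->
    (forall s, 0 <= h s) -> \int[nu]_t h t = iint mu n h.
Proof.
elim: n => [|n [nu nuE]].
  exists (@dirac _ _ ([tuple] : 0.-tuple T) R) => h mh h0.
  by rewrite integral_dirac// diracT mul1e.
pose phi : {mfun (T * n.-tuple T)%type >-> n.+1.-tuple T} :=
  HB.pack (@consf n) (isMeasurableFun.Build _ _ _ _ _ (@measurable_consf n)).
exists (distribution (mu \x nu) phi) => h mh h0.
rewrite ge0_integral_distribution//.
rewrite (fubini_tonelli1 (h \o val \o @consf n)) //=.
  apply: eq_integral => x _; rewrite /fubini_F -nuE//.
  exact: measurable_cons_section.
by apply: (measurableT_comp mh); exact: measurable_consf.
Qed.

Lemma measurable_iint n (h : seq T -> \bar R) :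
  measurable_fun [set: n.+1.-tuple T] (h \o val) -> (forall s, 0 <= h s) ->
  measurable_fun setT (fun x => iint mu n (fun s => h (x :: s))).
Proof.
move=> mh h0; have [nu nuE] := iint_tuple n.
have -> : (fun x => iint mu n (fun s => h (x :: s))) =
    fubini_F nu (h \o val \o @consf n).
  by apply/funext => x; rewrite /fubini_F -nuE//; exact: measurable_cons_section.
apply: measurable_fun_fubini_tonelli_F; last by move=> x; exact: h0.
by apply: (measurableT_comp mh); exact: measurable_consf.
Qed.

Fixpoint box (As : seq (set T)) (s : seq T) : \bar R :=
  match As, s with A :: As', x :: s' => (\1_A x)%:E * box As' s' | _, _ => 1 end.

Lemma box_ge0 As s : 0 <= box As s.
Proof. by elim: As s => [|A As IH] [|x s] //=; rewrite mule_ge0. Qed.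

Lemma iintZl n (k : \bar R) (h : seq T -> \bar R) :
  0 <= k -> (forall s, 0 <= h s) -> measurable_fun [set: n.-tuple T] (h \o val) ->
  iint mu n (fun s => k * h s) = k * iint mu n h.
Proof.
elim: n h => [//|n IH] h k0 h0 mh /=.
rewrite -ge0_integralZl//; first last.
- by move=> x _; exact: iint_ge0.
- exact: measurable_iint.
by apply: eq_integral => x _; rewrite IH//; exact: measurable_cons_section.
Qed.

Lemma measurable_box n As : {in As, forall A, measurable A} ->
  measurable_fun [set: n.-tuple T] (box As \o val).
Proof.
elim: As n => [|A As IH] n mA /=; first exact: measurable_cst.
case: n => [|n].
  rewrite (_ : _ \o _ = cst 1); first exact: measurable_cst.
  by apply/funext => t; rewrite /= tuple0.
rewrite (_ : _ \o _ = fun t : n.+1.-tuple T =>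
    (\1_A (tnth t ord0))%:E * (box As \o val) [tuple of behead t]).
  apply: emeasurable_funM.
    apply/measurable_EFinP.
    have m1 : measurable_fun setT (\1_A : T -> R).
      by apply: measurable_indic; apply: mA; exact: mem_head.
    exact: (measurableT_comp m1 (measurable_tnth ord0)).
  apply: (measurableT_comp (IH n _)); last exact: measurable_behead.
  by move=> B BAs; apply: mA; rewrite inE BAs orbT.
by apply/funext => -[[|x s] sn].
Qed.

Lemma iint_box As : {in As, forall A, measurable A} ->
  iint mu (size As) (box As) = \prod_(A <- As) mu A.
Proof.
elim: As => [|A As IH] mA /=; first by rewrite big_nil.
have mAs : {in As, forall A, measurable A}.
  by move=> B BAs; apply: mA; rewrite inE BAs orbT.
have mA0 : measurable A by apply: mA; exact: mem_head.
rewrite big_cons -IH//.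
transitivity (\int[mu]_x ((\1_A x)%:E * iint mu (size As) (box As))).
  apply: eq_integral => x _; rewrite iintZl//; first by move=> s; exact: box_ge0.
  exact: measurable_box.
rewrite ge0_integralZr//; first by rewrite integral_indic// setIT.
- exact/measurable_EFinP/measurable_indic.
- by apply: iint_ge0 => s; exact: box_ge0.
Qed.

End iterated_integral.

Lemma measurable_mktuple d d' (Omega : measurableType d') (T : measurableType d) (n : nat)
    (X : 'I_n -> Omega -> T) : (forall i, measurable_fun setT (X i)) ->
  measurable_fun setT (fun w => [tuple X i w | i < n]).
Proof.
move=> mX; apply/measurable_fun_tnthP => i; rewrite (_ : _ \o _ = X i)//.
by apply/funext => w /=; rewrite tnth_mktuple.
Qed.

Section law.
Context (R : realType) d (T : measurableType d) (mu : probability T R).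
Context d' (Omega : measurableType d') (P : probability Omega R).
Variables (n : nat) (X : 'I_n -> {RV P >-> T}).
Hypothesis Xindep : mutually_independent X.
Hypothesis Xmu : forall i A, measurable A -> distribution P (X i) A = mu A.
Local Open Scope ereal_scope.

Let boxset (A : 'I_n -> set T) : set (n.-tuple T) := [set t | forall i, A i (tnth t i)].
Let G : set (set (n.-tuple T)) :=
  [set boxset A | A in [set A | forall i, measurable (A i)]].

Let measurable_boxset A : (forall i, measurable (A i)) -> measurable (boxset A).
Proof.
move=> mA; have -> : boxset A = \bigcap_(i in [set: 'I_n]) ((@tnth n T)^~ i @^-1` A i).
  by apply/seteqP; split=> t /= tA i; [move=> _; exact: tA|exact: tA].
apply: fin_bigcap_measurable => // i _; rewrite -[X in measurable X]setTI.
exact: measurable_tnth.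
Qed.

Let measurableG : measurable = <<s G >>.
Proof.
apply/seteqP; split; last first.
  apply: smallest_sub; first exact: sigma_algebra_measurable.
  by move=> _ [A mA <-]; exact: measurable_boxset.
apply: smallest_sub; first exact: smallest_sigma_algebra.
move=> B; rewrite -bigcup_seq => -[i _ [A mA <-]].
apply: sub_sigma_algebra; exists (fun j => if j == i then A else setT).
  by move=> j; case: ifP.
rewrite setTI; apply/seteqP; split=> t /=; first by move=> /(_ i); rewrite eqxx.
by move=> tA j; case: eqP => // ->.
Qed.

Let Xt (w : Omega) : n.-tuple T := [tuple X i w | i < n].

Let measurable_Xt : measurable_fun setT Xt.
Proof. exact: measurable_mktuple. Qed.

(** By independence the law of the sample agrees with the iterated integral on product sets; these
    are stable under intersection and generate the sigma-algebra, so the two measures coincide. *)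
Lemma integral_iint (h : seq T -> \bar R) :
  measurable_fun [set: n.-tuple T] (h \o val) -> (forall s, 0 <= h s) ->
  \int[P]_w h (codom (X^~ w)) = iint mu n h.
Proof.
move=> mh h0.
pose Y : {mfun Omega >-> n.-tuple T} :=
  HB.pack Xt (isMeasurableFun.Build _ _ _ _ _ measurable_Xt).
have [nu nuE] := iint_tuple mu n.
rewrite -nuE//.
have agree A : G A -> distribution P Y A = nu A.
  move=> [B mB <-].
  have mBs : {in map B (enum 'I_n), forall C, measurable C}.
    by move=> _ /mapP[i _ ->].
  transitivity (\prod_(C <- map B (enum 'I_n)) mu C).
    rewrite big_map big_enum /= -(eq_bigr _ (fun i _ => Xmu i (mB i))).
    transitivity (P (\bigcap_(i in [set` [set: 'I_n]%SET]) X i @^-1` B i)).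
      congr (P _); apply/seteqP; split=> w /=.
        by move=> wB i _; have := wB i; rewrite tnth_mktuple.
      by move=> wB i; rewrite tnth_mktuple; apply: wB; rewrite /= inE.
    by rewrite Xindep//; apply: eq_bigl => i; rewrite inE.
  rewrite -iint_box//= size_map size_enum_ord -nuE//; first last.
  - by move=> s; exact: box_ge0.
  - exact: measurable_box.
  transitivity (\int[nu]_t (\1_(boxset B) t)%:E); last first.
    by rewrite integral_indic// ?setIT//; exact: measurable_boxset.
  apply: eq_integral => t _; rewrite -{1}(map_tnth_enum t) /=.
  transitivity ((all (fun i => tnth t i \in B i) (enum 'I_n))%:R : R)%:E.
    elim: (enum 'I_n) => [//|i s /= ->]; rewrite indicE.
    by case: (_ \in B i); rewrite ?mul1e ?mul0e.
  rewrite indicE; congr (_%:R%:E); congr nat_of_bool; apply/allP/idP => tB.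
    by rewrite inE => i; apply/set_mem/tB; rewrite mem_enum.
  by move=> i _; rewrite inE; move: tB; rewrite inE; exact.
transitivity (\int[distribution P Y]_t h (val t)); last first.
  apply: eq_measure_integral => A mA _; apply: (measure_unique G (fun=> setT)) => //.
  - move=> _ _ [A1 mA1 <-] [A2 mA2 <-]; exists (fun i => A1 i `&` A2 i).
      by move=> i; exact: measurableI.
    apply/seteqP; split=> t /=; first by move=> tA; split=> i; have [] := tA i.
    by move=> [t1 t2] i; split.
  - by move=> _; exists (fun=> setT) => //; apply/seteqP; split.
  - by apply/seteqP; split=> // t _; exists 0%N.
  - by move=> k; apply: le_lt_trans (ltry 1); exact: (@probability_le1 _ _ _ (distribution P Y)).
have hv0 (t : n.-tuple T) : 0 <= (h \o val) t by exact: h0.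
rewrite (ge0_integral_distribution Y mh hv0); apply: eq_integral => w _; congr h; rewrite /= codomE.
Qed.

End law.

(** * Thinning an independent sample *)

Section thinning.
Context (R : realType) d (T : measurableType d) (mu : probability T R).
Variables (a b : pred T) (psi : T -> T) (alpha beta : R).
Hypothesis ab : forall x, a x -> ~~ b x.
Hypothesis ma : measurable [set x | a x].
Hypothesis mb : measurable [set x | b x].
Hypothesis mpsi : measurable_fun [set x | a x] psi.
Hypothesis alpha0 : 0 <= alpha.
Hypothesis beta0 : 0 <= beta.
Local Open Scope ereal_scope.
Hypothesis mu_psi : forall f : T -> \bar R, measurable_fun setT f -> (forall x, 0 <= f x) ->
  \int[mu]_(x in [set x | a x]) f (psi x) = alpha%:E * \int[mu]_x f x.
Hypothesis mu_b : mu [set x | b x] = beta%:E.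

Let coef n m : R := ('C(n, m)%:R * alpha ^+ m * beta ^+ (n - m))%R.

Let coef0 n m : 0 <= (coef n m)%:E.
Proof. by rewrite lee_fin !mulr_ge0 ?exprn_ge0. Qed.

(* Points satisfying [b] are discarded, those satisfying [a] are rescaled by [psi]
   to [mu]-distributed points. *)
Lemma iint_thinning n (h : seq T -> \bar R) :
  (forall m, measurable_fun [set: m.-tuple T] (h \o val)) -> (forall s, 0 <= h s) ->
  iint mu n (fun s => if all (predU a b) s then h (map psi [seq x <- s | a x]) else 0) =
  \sum_(m < n.+1) (coef n m)%:E * iint mu m h.
Proof.
elim: n h => [|n IH] h mh h0; first by rewrite big_ord1 /coef /= bin0 !expr0 !mulr1 mul1e.
pose Phi (h : seq T -> \bar R) := \sum_(m < n.+1) (coef n m)%:E * iint mu m h.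
have Phi0 g : (forall s, 0 <= g s) -> 0 <= Phi g.
  by move=> g0; apply: sume_ge0 => m _; rewrite mule_ge0 ?coef0//; exact: iint_ge0.
have mPhi : measurable_fun setT (fun x => Phi (fun s => h (x :: s))).
  apply: emeasurable_sum => m.
  by apply: emeasurable_funM; [exact: measurable_cst|exact: measurable_iint].
(* Split on the first point: [f1] is its contribution when kept, [f2] when discarded; a point with
   neither property contributes 0. *)
pose f1 x := if a x then Phi (fun s => h (psi x :: s)) else 0.
pose f2 x := if b x then Phi h else 0.
have -> : iint mu n.+1 (fun s => if all (predU a b) s
    then h (map psi [seq x <- s | a x]) else 0) = \int[mu]_x (f1 x + f2 x).
  apply: eq_integral => x _; rewrite /f1 /f2.
  have [ax|ax] := boolP (a x).
    rewrite (negPf (ab ax)) adde0 /Phi -IH//; last by move=> m; exact: measurable_cons_section.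
    by apply: iint_eq => s _; rewrite /= ax.
  have [bx|bx] := boolP (b x).
    by rewrite add0e /Phi -IH//; apply: iint_eq => s _; rewrite /= (negPf ax) bx.
  rewrite adde0; transitivity (iint mu n (fun=> 0)).
    by apply: iint_eq => s _; rewrite /= (negPf ax) (negPf bx).
  by elim: (n) => [//|k IHk] /=; rewrite integral0_eq.
have f1E : f1 = (fun x => Phi (fun s => h (psi x :: s))) \_ [set x | a x].
  by apply/funext => x; rewrite /f1 patchE mem_setE.
have f2E : f2 = (cst (Phi h)) \_ [set x | b x].
  by apply/funext => x; rewrite /f2 patchE mem_setE.
rewrite ge0_integralD//; last 4 first.
- by move=> x _; rewrite /f1; case: ifP => // _; exact: Phi0.
- rewrite f1E; apply/(measurable_restrictT _ _).1 => //.
  exact: (measurableT_comp mPhi).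
- by move=> x _; rewrite /f2; case: ifP => // _; exact: Phi0.
- by rewrite f2E; apply/(measurable_restrictT _ _).1 => //; exact: measurable_cst.
have -> : \int[mu]_x f1 x = alpha%:E * \int[mu]_x Phi (fun s => h (x :: s)).
  by rewrite f1E -integral_mkcond; apply: (mu_psi mPhi) => x; exact: Phi0.
have -> : \int[mu]_x f2 x = beta%:E * Phi h.
  by rewrite f2E -integral_mkcond integral_cst// muleC; congr (_ * _); exact: mu_b.
rewrite {1}/Phi ge0_integral_sum//; last 2 first.
- by move=> m; apply: emeasurable_funM; [exact: measurable_cst|exact: measurable_iint].
- by move=> m x _; rewrite mule_ge0 ?coef0//; exact: iint_ge0.
have J0 m : 0 <= iint mu m h by exact: iint_ge0.
rewrite /Phi !ge0_sume_distrr//; last 2 first.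
- by move=> m _; rewrite mule_ge0 ?coef0.
- by move=> m _; apply: integral_ge0 => x _; rewrite mule_ge0 ?coef0//; exact: iint_ge0.
(* Pascal's rule *)
have -> : \sum_(m < n.+2) (coef n.+1 m)%:E * iint mu m h =
    \sum_(m < n.+2) ((if val m is m'.+1 then alpha * coef n m' else 0)%R%:E * iint mu m h +
      (beta * coef n m)%R%:E * iint mu m h).
  apply: eq_bigr => m _; rewrite -ge0_muleDl//; last 2 first.
  - by rewrite lee_fin; case: (val m) => // m'; rewrite mulr_ge0// -lee_fin.
  - by rewrite lee_fin mulr_ge0// -lee_fin.
  congr (_ * _); rewrite -EFinD; congr EFin; rewrite /coef.
  case: m => [[|m'] mn] /=.
    by rewrite !bin0 !subn0 exprS; ring.
  rewrite binS subSS natrD exprS.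
  (* For m' = n the binomial 'C(n, m'.+1) vanishes; below n, one factor [beta] splits off the
     exponent n - m'. *)
  have [nm|mn'] := leqP n m'.
    by rewrite (bin_small (_ : n < m'.+1)%N)//; ring.
  by rewrite -(subnSK mn') exprS; ring.
rewrite big_split /=; congr (_ + _).
  rewrite [RHS]big_ord_recl mul0e add0e; apply: eq_bigr => m _ /=.
  rewrite ge0_integralZl//; first by rewrite muleA -EFinM.
  - exact: measurable_iint.
  - by move=> x _; exact: iint_ge0.
rewrite [RHS]big_ord_recr /= {3}/coef bin_small// !mul0r mulr0 mul0e adde0.
by apply: eq_bigr => m _; rewrite muleA -EFinM.
Qed.

End thinning.

(** * The uniform distribution on the triangle *)

Notation leb R := (@lebesgue_measure R).
Notation area R := (leb R \x leb R)%E.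

Section lebesgue_affine.
Context (R : realType).
Local Open Scope ereal_scope.

(** k times the pushforward of Lebesgue measure has the right value on half-open intervals, hence is
    Lebesgue measure. *)
Lemma integral_affine (h : measurableTypeR R -> \bar R) (k b : R) :
  (0 < k)%R -> measurable_fun setT h -> (forall x, 0 <= h x) ->
  \int[leb R]_x h (k * x + b)%R = k^-1%:E * \int[leb R]_x h x.
Proof.
move=> k0 mh h0.
pose f : measurableTypeR R -> measurableTypeR R := fun x => (k * x + b)%R.
have mf : measurable_fun setT f.
  by apply: measurable_funD => //; exact: measurable_funM.
have k0' : (0 <= k)%R by exact: ltW.
pose nu : {measure set (measurableTypeR R) -> \bar R} :=
  mscale (NngNum k0')
    (measure_function_pushforward__canonical__measure_function_Measure (leb R) mf).
have nuE A : measurable A -> leb R A = nu A.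
  apply: lebesgue_measure_unique => _ [[x y] _ <-] /=.
  rewrite /nu /= /mscale /= /pushforward.
  have -> : f @^-1` `]x, y]%classic = `]((x - b) / k)%R, ((y - b) / k)%R]%classic.
    apply/seteqP; split=> z /=; rewrite !in_itv /= /f ltr_pdivrMr// ler_pdivlMr//;
    by rewrite ltrBlDr lerBrDr mulrC.
  rewrite !lebesgue_measure_itv /= !lte_fin ltr_pM2r ?invr_gt0// ltrD2r.
  case: ifP => _; last by rewrite mule0.
  by rewrite -!EFinB -EFinM; congr EFin; field; rewrite gt_eqF.
transitivity (\int[pushforward (leb R) f]_x h x).
  by rewrite ge0_integral_pushforward//.
have -> : \int[leb R]_x h x = k%:E * \int[pushforward (leb R) f]_x h x.
  rewrite -(ge0_integral_mscale _ measurableT (NngNum k0') mh)//.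
  by apply: eq_measure_integral => A mA _; exact: nuE.
by rewrite muleA -EFinM mulVf ?mul1e// gt_eqF.
Qed.

(** For a fixed second coordinate the map is affine in the first, so Tonelli reduces to two affine
    substitutions. [corner_inv] has this form. *)
Lemma integral_shear (g : plane R -> \bar R) (k e c l : R) :
  (0 < k)%R -> (0 < l)%R -> measurable_fun setT g -> (forall p, 0 <= g p) ->
  \int[area R]_p g ((k * p.1 + e * p.2 + c)%R, (l * p.2)%R) =
  (k^-1 * l^-1)%R%:E * \int[area R]_p g p.
Proof.
move=> k0 l0 mg g0.
pose f : plane R -> plane R := fun p => ((k * p.1 + e * p.2 + c)%R, (l * p.2)%R).
have mf : measurable_fun setT f.
  apply: measurable_fun_pair; last by apply: measurable_funM.
  by apply: measurable_funD => //; apply: measurable_funD; apply: measurable_funM.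
rewrite (fubini_tonelli2 (g \o f) (measurableT_comp mg mf) (fun=> g0 _)).
rewrite (fubini_tonelli2 g mg g0) /fubini_G.
pose G := fubini_G (leb R) g.
have mG : measurable_fun setT G by exact: measurable_fun_fubini_tonelli_G.
have G0 y : 0 <= G y by exact: integral_ge0.
transitivity (\int[leb R]_y (k^-1%:E * G (l * y + 0)%R)).
  apply: eq_integral => y _; rewrite /G /fubini_G addr0.
  rewrite -(integral_affine (h := fun x => g (x, l * y)%R) (e * y + c))//.
    by apply: eq_integral => x _; rewrite /= /f /= addrA.
  exact: (measurableT_comp mg (pair2_measurable _)).
rewrite ge0_integralZl//; last 2 first.
- apply: (measurableT_comp mG).
  by apply: measurable_funD => //; exact: measurable_funM.
- by rewrite lee_fin invr_ge0 ltW.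
by rewrite integral_affine// muleA -EFinM.
Qed.

End lebesgue_affine.

Section triangle.
Context (R : realType).
Local Open Scope ereal_scope.

Lemma measurable_open_triangle : measurable (@open_triangle R).
Proof.
have -> : @open_triangle R = [set p | (0 < p.1)%R && (0 < p.2)%R && (p.1 + p.2 < 1)%R].
  by apply/seteqP; split=> p /=; [move=> [-> -> ->]|move=> /andP[/andP[]]].
rewrite -[X in measurable X]setTI.
have mb : measurable_fun [set: plane R]
    (fun p => (0 < p.1)%R && (0 < p.2)%R && (p.1 + p.2 < 1)%R).
  apply: measurable_and; first apply: measurable_and.
  - by apply: measurable_fun_ltr.
  - by apply: measurable_fun_ltr.
  - by apply: measurable_fun_ltr => //; exact: measurable_funD.
exact: (mb measurableT [set true]).
Qed.

Lemma triangleE : triangle R = [set p | [/\ 0 <= p.1, 0 <= p.2 & p.1 + p.2 <= 1]%R].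
Proof.
apply/seteqP; split.
  apply: convex_hull_min.
    move=> a b t [a1 a2 a3] [b1 b2 b3] /andP[t0 t1]; rewrite /cmb; split=> /=; nra.
  by move=> p [[]|] -> /=; split; lra.
move=> p [p1 p2 p3].
pose q : plane R := ((p.1 / (p.1 + p.2))%R, (p.2 / (p.1 + p.2))%R).
have T0 : triangle R (0%R, 0%R) by apply: sub_convex_hull; left; left.
have T1 : triangle R (0%R, 1%R) by apply: sub_convex_hull; left; right.
have T2 : triangle R (1%R, 0%R) by apply: sub_convex_hull; right.
have Tc : forall (a b : plane R) (t : R), triangle R a -> triangle R b ->
  (0 < t < 1)%R -> triangle R (cmb t a b) by move=> *; exact: convex_hull_cmb.
have [p0|p0] := eqVneq (p.1 + p.2)%R 0%R.
  have -> // : p = (0%R, 0%R).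
  by rewrite [LHS]surjective_pairing; congr pair; lra.
have s0 : (0 < p.1 + p.2)%R by rewrite lt_neqAle eq_sym p0 addr_ge0.
have -> : p = cmb (p.1 + p.2) (cmb (p.1 / (p.1 + p.2)) (1, 0) (0, 1))%R (0, 0)%R.
  by rewrite [LHS]surjective_pairing; congr pair => /=; field.
apply: cmb_itv => //; last by rewrite (ltW s0).
apply: cmb_itv => //.
by rewrite divr_ge0 ?(ltW s0)// ler_pdivrMr// mul1r lerDl.
Qed.

Lemma integral_beta (a b : nat) :
  \int[leb R]_(x in `]0%R, 1%R[) (x ^+ a * (1 - x) ^+ b)%R%:E =
  (a`!%:R * b`!%:R / (a + b).+1`!%:R)%R%:E.
Proof.
rewrite -(@integral_itv_bndoo _ _ _ _ true false); last first.
  apply/measurable_EFinP; apply: measurable_funM; apply: measurable_funX => //.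
  exact: measurable_funB.
have := @beta_fun_fact R a b; rewrite natrM => <-.
by rewrite EFin_beta_fun integral_XMonemX_restrict setTI.
Qed.

(** The substitution u = x / (1 - y) leaves a beta integral with first exponent 0. *)
Let integral_section n m (y : R) : (0 < y < 1)%R ->
  \int[leb R]_x (if (0 < x < 1 - y)%R then
    ((y / (1 - y)) ^+ m * (1 - x - y) ^+ n)%R%:E else 0) =
  ((y / (1 - y)) ^+ m * (1 - y) ^+ n.+1 / n.+1%:R)%R%:E.
Proof.
move=> /andP[y0 y1]; pose c := (1 - y)%R.
have c0 : (0 < c)%R by rewrite subr_gt0.
pose h (u : measurableTypeR R) := if (0 < u < 1)%R then ((1 - u) ^+ n)%R%:E else 0.
have hE : h = (fun u => (u ^+ 0 * (1 - u) ^+ n)%R%:E) \_ `]0%R, 1%R[.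
  by apply/funext => u; rewrite /h patchE mem_setE in_itv /= expr0 mul1r.
have mh : measurable_fun setT h.
  rewrite hE; apply/(measurable_restrictT _ _).1 => //; apply/measurable_EFinP.
  by apply: measurable_funM; apply: measurable_funX => //; exact: measurable_funB.
have h0 u : 0 <= h u.
  by rewrite /h; case: ifP => // /andP[_ u1]; rewrite lee_fin exprn_ge0// subr_ge0 ltW.
have c'0 : (0 < c^-1)%R by rewrite invr_gt0.
transitivity (\int[leb R]_x (((y / c) ^+ m * c ^+ n)%R%:E * h (c^-1 * x + 0)%R)).
  apply: eq_integral => x _; rewrite /h addr0 (mulrC _ x).
  rewrite pmulr_lgt0// ltr_pdivrMr// mul1r; case: ifP => _; last by rewrite mule0.
  rewrite -EFinM -mulrA -exprMn; congr (_ * _ ^+ n)%R%:E.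
  by rewrite mulrBr mulr1 mulrCA divff ?mulr1 ?gt_eqF// /c; ring.
rewrite ge0_integralZl//; last 2 first.
- have ma : measurable_fun setT (fun x : measurableTypeR R => (c^-1 * x + 0)%R : measurableTypeR R).
    by apply: measurable_funD => //; exact: measurable_funM.
  exact: (measurableT_comp mh ma).
- by rewrite lee_fin mulr_ge0// exprn_ge0// ?divr_ge0// ltW.
rewrite integral_affine// invrK hE -integral_mkcond integral_beta fact0 mul1r add0n.
rewrite -!EFinM; congr EFin; rewrite -/c exprS factS natrM.
by field; rewrite gt_eqF//= pnatr_eq0 -lt0n fact_gt0.
Qed.

Lemma measurable_triangle_density (n m : nat) :
  measurable_fun (@open_triangle R)
    (fun p => ((p.2 / (1 - p.2)) ^+ m * (1 - p.1 - p.2) ^+ n)%R%:E).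
Proof.
(* The power with exponent -1 is measurable everywhere and agrees with the inverse where [1 - p.2]
   is positive, hence on the triangle. *)
pose g' (p : plane R) : \bar R :=
  ((p.2 * (1 - p.2) `^ (-1)) ^+ m * (1 - p.1 - p.2) ^+ n)%R%:E.
have mg' : measurable_fun setT g'.
  apply/measurable_EFinP; apply: measurable_funM; apply: measurable_funX.
    apply: measurable_funM => //.
    have m1 : measurable_fun setT (fun p : plane R => 1 - p.2)%R by exact: measurable_funB.
    exact: (measurableT_comp (measurable_powR _) m1).
  by apply: measurable_funB => //; exact: measurable_funB.
apply: (eq_measurable_fun g') (measurable_funTS mg').
by move=> p /set_mem[p1 p2 p3]; rewrite /g' powR_inv1//; lra.
Qed.

(** Integrating over x first leaves y^m (1 - y)^(n + 1 - m) / (n + 1), a beta integrand; [m <= n]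
    lets the powers of 1 - y cancel. *)
Lemma integral_open_triangle (n m : nat) : (m <= n)%N ->
  \int[area R]_(p in @open_triangle R) ((p.2 / (1 - p.2)) ^+ m * (1 - p.1 - p.2) ^+ n)%R%:E =
  (m`!%:R * (n.+1 - m)`!%:R / (n.+1%:R * n.+2`!%:R))%R%:E.
Proof.
move=> mn; pose g (p : plane R) : \bar R :=
  ((p.2 / (1 - p.2)) ^+ m * (1 - p.1 - p.2) ^+ n)%R%:E.
rewrite -[LHS]/(\int[area R]_(p in @open_triangle R) g p) integral_mkcond.
have simp (y : R) : (1 - y != 0 -> (y / (1 - y)) ^+ m * (1 - y) ^+ n.+1 / n.+1%:R =
    n.+1%:R^-1 * (y ^+ m * (1 - y) ^+ (n.+1 - m)))%R.
  move=> y10; rewrite expr_div_n -[in ((1 - y) ^+ n.+1)%R](subnK (leqW mn)) exprD.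
  have : (n.+1%:R != 0 :> R)%R by rewrite pnatr_eq0.
  by move: (n.+1%:R)%R => N N0; field; rewrite N0 expf_neq0.
have mg : measurable_fun (@open_triangle R) g by exact: measurable_triangle_density.
have {}mg : measurable_fun setT (g \_ @open_triangle R).
  exact: (measurable_restrictT g measurable_open_triangle).1.
have g0 p : 0 <= (g \_ @open_triangle R) p.
  rewrite patchE; case: ifPn => // /set_mem[p1 p2 p3].
  by rewrite /g lee_fin mulr_ge0// exprn_ge0 ?divr_ge0//; lra.
rewrite (fubini_tonelli2 _ mg g0) /fubini_G.
transitivity (\int[leb R]_(y in `]0%R, 1%R[)
    ((n.+1%:R^-1)%R%:E * (y ^+ m * (1 - y) ^+ (n.+1 - m))%R%:E)).
  rewrite [RHS]integral_mkcond; apply: eq_integral => y _.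
  rewrite patchE mem_setE in_itv /=.
  have [/[dup] y01 /andP[y0 y1]|y01] := ifPn.
    transitivity (((y / (1 - y)) ^+ m * (1 - y) ^+ n.+1 / n.+1%:R)%R%:E).
      rewrite -integral_section//; apply: eq_integral => x _; rewrite patchE.
      have -> : ((x, y) \in @open_triangle R) = (0 < x < 1 - y)%R.
        apply/idP/idP => [/set_mem[/= x0 _ xy]|/andP[x0 xy]]; first by rewrite x0 /=; lra.
        by apply/mem_set; split=> //=; lra.
      by [].
    by rewrite -EFinM; congr EFin; apply: simp; rewrite gt_eqF// subr_gt0.
  rewrite integral0_eq// => x _; rewrite patchE; case: ifPn => // /set_mem[/= x0 y0 xy].
  by case/negP: y01; lra.
rewrite ge0_integralZl//; last 2 first.
- apply/measurable_EFinP; apply: measurable_funM; apply: measurable_funX => //.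
  exact: measurable_funB.
- move=> y /=; rewrite in_itv /= => /andP[y0 y1].
  by rewrite lee_fin mulr_ge0// exprn_ge0//; lra.
rewrite integral_beta -EFinM; congr EFin.
by rewrite subnKC ?leqW// invfM; ring.
Qed.

End triangle.

Section uniform.
Context (R : realType) (mu : probability (plane R) R).
Local Open Scope ereal_scope.
Hypothesis muE : forall A : set (plane R), measurable A ->
  mu A = area R (A `&` triangle R) / area R (triangle R).

Let T := @open_triangle R.
Let mT : measurable T := @measurable_open_triangle R.

Let area_open_triangle : area R T = (2^-1)%R%:E.
Proof.
transitivity (\int[area R]_(p in T) 1%R%:E); first by rewrite integral_cst// mul1e.
transitivity (\int[area R]_(p in T) ((p.2 / (1 - p.2)) ^+ 0 * (1 - p.1 - p.2) ^+ 0)%R%:E).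
  by apply: eq_integral => p _; rewrite !expr0 mulr1.
by rewrite integral_open_triangle//= fact0 !mul1r; congr EFin;
  rewrite -[(1`!)%N]/1%N -[(2`!)%N]/2%N mul1r.
Qed.

Let measurable_triangle : measurable (triangle R).
Proof.
have -> : triangle R = [set p | (0 <= p.1)%R && (0 <= p.2)%R && (p.1 + p.2 <= 1)%R].
  by rewrite triangleE; apply/seteqP; split=> p /=; [move=> [-> -> ->]|move=> /andP[/andP[]]].
rewrite -[X in measurable X]setTI.
have mb : measurable_fun [set: plane R]
    (fun p => (0 <= p.1)%R && (0 <= p.2)%R && (p.1 + p.2 <= 1)%R).
  apply: measurable_and; first apply: measurable_and.
  - by apply: measurable_fun_ler.
  - by apply: measurable_fun_ler.
  - by apply: measurable_fun_ler => //; exact: measurable_funD.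
exact: (mb measurableT [set true]).
Qed.

(** The lines carrying the three sides. They are null, so the closed triangle of the hypothesis can
    be traded for the open one used in the geometry. *)
Let L1 : set (plane R) := [set 0%R : measurableTypeR R] `*` setT.
Let L2 : set (plane R) := setT `*` [set 0%R : measurableTypeR R].
Let L3 : set (plane R) := [set p | (p.1 + p.2)%R = 1%R].

Let mL1 : measurable L1. Proof. exact: measurableX. Qed.
Let mL2 : measurable L2. Proof. exact: measurableX. Qed.

Let mL3 : measurable L3.
Proof.
have ms : measurable_fun [set: plane R] (fun p => p.1 + p.2 : R)%R by exact: measurable_funD.
by rewrite -[X in measurable X]setTI; exact: (ms measurableT [set 1%R]).
Qed.

Let area_L : area R (L1 `|` L2 `|` L3) = 0.
Proof.
have a1 : area R L1 = 0.
  transitivity (leb R [set 0%R] * leb R setT); first exact: product_measure1E.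
  by rewrite lebesgue_measure_set1 mul0e.
have a2 : area R L2 = 0.
  transitivity (leb R setT * leb R [set 0%R]); first exact: product_measure1E.
  by rewrite lebesgue_measure_set1 mule0.
have a3 : area R L3 = 0.
  rewrite /product_measure1 integral0_eq// => x _ /=.
  rewrite (_ : xsection L3 x = [set (1 - x)%R]) ?lebesgue_measure_set1//.
  apply/seteqP; split=> y; rewrite /xsection /= inE /L3 /=; lra.
by rewrite measureU0//; [rewrite measureU0|exact: measurableU].
Qed.

Let area_triangleI A : measurable A -> area R (A `&` triangle R) = area R (A `&` T).
Proof.
move=> mA; apply/eqP; rewrite eq_le; apply/andP; split; last first.
  apply: le_measure; rewrite ?inE; [exact: measurableI|exact: measurableI|].
  by apply: setIS => p [p1 p2 p3]; rewrite triangleE; split; exact: ltW.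
rewrite -(@measureU0 _ _ _ (area R) (A `&` T) (L1 `|` L2 `|` L3))//; last 2 first.
- exact: measurableI.
- by apply: measurableU => //; exact: measurableU.
apply: le_measure; rewrite ?inE.
- exact: measurableI.
- by apply: measurableU; [exact: measurableI|apply: measurableU => //; exact: measurableU].
move=> p [Ap]; rewrite triangleE => -[].
rewrite le_eqVlt => /predU1P[p1 _ _|p1]; first by right; left; left.
rewrite le_eqVlt => /predU1P[p2 _|p2]; first by right; left; right.
by rewrite le_eqVlt => /predU1P[p3|p3]; [right; right|left].
Qed.

Lemma uniform_measureE A : measurable A -> mu A = 2%:E * area R (A `&` T).
Proof.
move=> mA; rewrite muE// area_triangleI// -[triangle R]setTI area_triangleI// setTI.
rewrite area_open_triangle muleC inver invr_eq0 pnatr_eq0/= invrK.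
by [].
Qed.

Lemma integral_uniform_triangle (f : plane R -> \bar R) :
  measurable_fun T f -> (forall p, T p -> 0 <= f p) ->
  \int[mu]_(p in T) f p = 2%:E * \int[area R]_(p in T) f p.
Proof.
move=> mf f0; rewrite -(ge0_integral_mscale _ mT (2%:nng)%R mf)//.
apply: eq_measure_integral => A mA AT; transitivity (mu A); first by [].
by rewrite uniform_measureE// setIidl.
Qed.

Lemma integral_uniform_measure (f : plane R -> \bar R) :
  measurable_fun setT f -> (forall p, 0 <= f p) ->
  \int[mu]_p f p = 2%:E * \int[area R]_(p in T) f p.
Proof.
move=> mf f0; have mTC : measurable (~` T) by exact: measurableC.
have muTC : mu (~` T) = 0 by rewrite uniform_measureE// setICl measure0 mule0.
rewrite (@ge0_negligible_integral _ _ _ mu setT (~` T))//.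
rewrite setTD setCK.
by apply: integral_uniform_triangle => //; exact: measurable_funTS.
Qed.

End uniform.

(** For V in the open triangle, the open triangle V Q c: the image of [open_triangle] under
    [corner V]. *)
Definition in_corner (R : realType) (V W : plane R) : bool :=
  [&& 0 < W.1, 0 < W.2, W.1 + W.2 < 1, 0 < side_left V W & 0 < side_right V W].

(** The triangle a V c, with its side V c included so that nothing beyond the line a V is missed. *)
Definition in_cap (R : realType) (V W : plane R) : bool :=
  [&& 0 < W.1, 0 < W.2, W.1 + W.2 < 1, 0 < side_left V W & side_right V W <= 0].

Lemma measurable_corner_inv (R : realType) (V : plane R) :
  measurable_fun setT (corner_inv V).
Proof.
apply: measurable_fun_pair; apply: measurable_funM => //.
by apply: measurable_funB => //; apply: measurable_funD; apply: measurable_funM.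
Qed.

(** * Masses of the two subtriangles *)

Section corner_measure.
Context (R : realType) (mu : probability (plane R) R).
Local Open Scope ereal_scope.
Hypothesis muE : forall A : set (plane R), measurable A ->
  mu A = area R (A `&` triangle R) / area R (triangle R).
Variable V : plane R.
Hypothesis TV : open_triangle V.

Let T := @open_triangle R.
Let mT : measurable T := @measurable_open_triangle R.
Let d : R := (1 - V.1 - V.2)%R.

Let d0 : (0 < d)%R. Proof. by case: TV; rewrite /d; lra. Qed.

(** The density 2 cancels, leaving a Lebesgue change of variables; the hypotheses on [D] and [T] say
    that [D] is the preimage of [T]. *)
Let integral_shear_triangle (D : set (plane R)) (k e c l : R) (f : plane R -> \bar R) :
  (0 < k)%R -> (0 < l)%R -> measurable D -> D `<=` T ->
  (forall p, T p -> D p <-> T ((k * p.1 + e * p.2 + c)%R, (l * p.2)%R)) ->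
  (forall p, T ((k * p.1 + e * p.2 + c)%R, (l * p.2)%R) -> T p) ->
  measurable_fun setT f -> (forall p, 0 <= f p) ->
  \int[mu]_(p in D) f ((k * p.1 + e * p.2 + c)%R, (l * p.2)%R) =
  (k^-1 * l^-1)%R%:E * \int[mu]_p f p.
Proof.
move=> k0 l0 mD DT DE TT mf f0.
pose s (p : plane R) : plane R := ((k * p.1 + e * p.2 + c)%R, (l * p.2)%R).
have ms : measurable_fun setT s.
  apply: measurable_fun_pair; last by apply: measurable_funM.
  by apply: measurable_funD => //; apply: measurable_funD; apply: measurable_funM.
have mfs : measurable_fun setT (f \o s) by exact: measurableT_comp.
have mfT : measurable_fun setT (f \_ T).
  exact: (measurable_restrictT f mT).1 (measurable_funTS mf).
have rest0 (g : plane R -> \bar R) (A : set (plane R)) p :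
    (forall p, 0 <= g p) -> 0 <= (g \_ A) p.
  by move=> g0; rewrite patchE; case: ifP.
rewrite -[LHS]/(\int[mu]_(p in D) (f \o s) p) integral_mkcond.
have mfsD : measurable_fun setT ((f \o s) \_ D).
  exact: (measurable_restrictT (f \o s) mD).1 (measurable_funTS mfs).
rewrite (integral_uniform_measure muE mfsD); last by move=> p; apply: rest0 => q; exact: f0.
rewrite (integral_uniform_measure muE)// muleCA; congr (_ * _).
rewrite [X in _ = _ * X]integral_mkcond -(integral_shear e c)//; last first.
  by move=> p; exact: rest0.
rewrite integral_mkcond; apply: eq_integral => p _; rewrite !patchE.
have [Tp|nTp] := boolP (p \in _); last first.
  rewrite ifF//; apply/negP => /set_mem/TT Tp.
  by case/negP: nTp; apply/mem_set.
have := DE p (set_mem Tp).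
have [Dp [/(_ (set_mem Dp)) sT _]|nDp [_ sT]] := boolP (p \in D).
  by rewrite ifT//; exact/mem_set.
by rewrite ifF//; apply/negP => /set_mem/sT Dp; case/negP: nDp; exact/mem_set.
Qed.

Let measurable_left : measurable_fun setT (side_left V : plane R -> R).
Proof.
by apply: measurable_funB => //; apply: measurable_funD; apply: measurable_funM.
Qed.

Let measurable_right : measurable_fun setT (side_right V : plane R -> R).
Proof.
by apply: measurable_funB => //; apply: measurable_funM => //; exact: measurable_funB.
Qed.

Let measurable_T : measurable_fun setT
  (fun p : plane R => [&& 0 < p.1, 0 < p.2 & p.1 + p.2 < 1]%R).
Proof.
apply: measurable_and; last apply: measurable_and.
- by apply: measurable_fun_ltr.
- by apply: measurable_fun_ltr.
- by apply: measurable_fun_ltr => //; exact: measurable_funD.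
Qed.

Lemma measurable_in_corner : measurable [set W | in_corner V W].
Proof.
have mb : measurable_fun setT (in_corner V).
  rewrite (_ : in_corner V = fun p : plane R => [&& 0 < p.1, 0 < p.2 & p.1 + p.2 < 1]%R &&
      ((0 < side_left V p)%R && (0 < side_right V p)%R)); last first.
    by apply/funext => p; rewrite /in_corner -!andbA.
  apply: measurable_and => //; apply: measurable_and; exact: measurable_fun_ltr.
by rewrite -[X in measurable X]setTI; exact: (mb measurableT [set true]).
Qed.

Lemma measurable_in_cap : measurable [set W | in_cap V W].
Proof.
have mb : measurable_fun setT (in_cap V).
  rewrite (_ : in_cap V = fun p : plane R => [&& 0 < p.1, 0 < p.2 & p.1 + p.2 < 1]%R &&
      ((0 < side_left V p)%R && (side_right V p <= 0)%R)); last first.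
    by apply/funext => p; rewrite /in_cap -!andbA.
  apply: measurable_and => //; apply: measurable_and; first exact: measurable_fun_ltr.
  exact: measurable_fun_ler.
by rewrite -[X in measurable X]setTI; exact: (mb measurableT [set true]).
Qed.

Let kE : ((1 - V.2) / d > 0)%R.
Proof. by case: TV => ? ? ?; rewrite divr_gt0//; lra. Qed.

Let firstE (p : plane R) :
  ((1 - V.2) / d * p.1 + V.1 / d * p.2 + - (V.1 / d))%R = (side_left V p / d)%R.
Proof. by rewrite /side_left; ring. Qed.

Let left_gt0 (p : plane R) : (0 < side_left V p / d)%R = (0 < side_left V p)%R.
Proof. by rewrite pmulr_lgt0// invr_gt0. Qed.

(** The map sends the line V c to the hypotenuse, so the two defects differ by positive factors
    only. *)
Let right_gt0 (p : plane R) :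
  (side_left V p / d + V.2^-1 * p.2 < 1)%R = (0 < side_right V p)%R.
Proof.
case: TV => V1 V2 V3.
have E : ((1 - (side_left V p / d + V.2^-1 * p.2)) * (d * V.2) =
    (1 - V.2) * side_right V p)%R.
  by rewrite /side_left /side_right /d; field; rewrite !gt_eqF//; lra.
rewrite -subr_gt0 -(pmulr_lgt0 _ (mulr_gt0 d0 V2)) E pmulr_rgt0//; lra.
Qed.

Lemma integral_corner (f : plane R -> \bar R) :
  measurable_fun setT f -> (forall p, 0 <= f p) ->
  \int[mu]_(W in [set W | in_corner V W]) f (corner_inv V W) =
  (V.2 * (1 - V.1 - V.2) / (1 - V.2))%R%:E * \int[mu]_p f p.
Proof.
case: TV => V1 V2 V3 mf f0.
have -> : (V.2 * (1 - V.1 - V.2) / (1 - V.2) = ((1 - V.2) / d)^-1 * (V.2^-1)^-1)%R.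
  by rewrite invrK invf_div -/d; ring.
rewrite -(@integral_shear_triangle [set W | in_corner V W] _ (V.1 / d) (- (V.1 / d)))//.
- by apply: eq_integral => p _; rewrite firstE /corner_inv (mulrC V.2^-1%R).
- by rewrite invr_gt0.
- exact: measurable_in_corner.
- by move=> p /and5P[].
- move=> p [p1 p2 p3]; rewrite firstE /= /in_corner p1 p2 p3 /=; split.
    by move=> /andP[l r]; split=> /=; rewrite ?left_gt0 ?right_gt0// mulr_gt0 ?invr_gt0.
  by move=> [/=]; rewrite left_gt0 right_gt0 => -> _ ->.
move=> p [/=]; rewrite firstE => x0 y0 xy.
(* x, y and 1 - x - y are the barycentric coordinates of p with respect to c, V and Q = (V.1 / (1 -
   V.2), 0); positive weights put p in the open triangle. *)
pose x := (side_left V p / d)%R; pose y := (V.2^-1 * p.2)%R.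
have z0 : (0 < (1 - x - y) / (1 - V.2))%R by rewrite divr_gt0// /x /y; lra.
have p1E : (p.1 = x + y * V.1 + (1 - x - y) / (1 - V.2) * V.1)%R.
  by rewrite /x /y /side_left /d; field; rewrite !gt_eqF//; lra.
have sE : (1 - p.1 - p.2 = y * d + (1 - x - y) / (1 - V.2) * d)%R.
  by rewrite /x /y /side_left /d; field; rewrite !gt_eqF//; lra.
split.
- by rewrite p1E !addr_gt0// mulr_gt0.
- by rewrite -(pmulr_rgt0 _ (_ : 0 < V.2^-1)%R)// invr_gt0.
- by rewrite -subr_gt0 opprD addrA sE addr_gt0// mulr_gt0.
Qed.

Let integral1 (B : set (plane R)) : measurable B -> \int[mu]_(p in B) cst 1 p = mu B.
Proof. by move=> mB; rewrite integral_cst// mul1e. Qed.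

(** The cap has no horizontal side, so the shears do not reach it; its mass comes by subtraction.
    The triangle a Q c has mass (1 - V.1 - V.2) / (1 - V.2), and the corner takes the fraction V.2
    of it. *)
Lemma measure_cap : mu [set W | in_cap V W] = (1 - V.1 - V.2)%R%:E.
Proof.
case: TV => V1 V2 V3.
pose D := [set W | in_corner V W] `|` [set W | in_cap V W].
have mD : measurable D by exact: measurableU measurable_in_corner measurable_in_cap.
have DE p : D p <-> T p /\ (0 < side_left V p)%R.
  rewrite /D /= /in_corner /in_cap; split.
    by move=> [/and5P[? ? ? ? _]|/and5P[? ? ? ? _]].
  move=> [[-> -> ->] ->] /=.
  by have [|] := ltP 0%R (side_right V p); [left|right].
have muD : mu D = ((1 - V.1 - V.2) / (1 - V.2))%R%:E.
  rewrite -integral1//.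
  transitivity ((((1 - V.2) / d)^-1 * 1^-1)%R%:E * \int[mu]_p cst 1 p); last first.
    by rewrite integral1// probability_setT mule1 invr1 mulr1 invf_div.
  apply: (@integral_shear_triangle D _ (V.1 / d) (- (V.1 / d)) 1 (cst 1)) => //.
  - by move=> p /DE[].
  - move=> p Tp; rewrite DE firstE mul1r; case: (Tp) => p1 p2 p3.
    have -> : T ((side_left V p / d)%R, p.2) <->
        [/\ (0 < side_left V p)%R, (0 < p.2)%R & (side_left V p / d + p.2 < 1)%R].
      by rewrite /T /open_triangle /= left_gt0.
    have E : ((1 - (side_left V p / d + p.2)) * d = (1 - V.2) * (1 - p.1 - p.2))%R.
      by rewrite /side_left /d; field; rewrite gt_eqF//; lra.
    split=> [[_ l]|[//]]; split=> //.
    by rewrite -subr_gt0 -(pmulr_lgt0 _ d0) E mulr_gt0//; lra.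
  - move=> p [/=]; rewrite firstE mul1r => x0 y0 xy.
    have E : ((1 - (side_left V p / d + p.2)) * d = (1 - V.2) * (1 - p.1 - p.2))%R.
      by rewrite /side_left /d; field; rewrite gt_eqF//; lra.
    split=> //; last first.
      by rewrite -subr_gt0 opprD addrA -(pmulr_rgt0 _ (_ : 0 < 1 - V.2)%R) -?E ?mulr_gt0//; lra.
    move: x0; rewrite left_gt0 /side_left => l0.
    rewrite -(pmulr_rgt0 _ (_ : 0 < 1 - V.2)%R); last by lra.
    have : (0 < V.1 * (1 - p.2))%R by
      rewrite mulr_gt0//; have := divr_gt0 (l0 : 0 < side_left V p)%R d0; lra.
    by lra.
have muC : mu [set W | in_corner V W] = (V.2 * (1 - V.1 - V.2) / (1 - V.2))%R%:E.
  rewrite -integral1; last exact: measurable_in_corner.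
  transitivity ((V.2 * (1 - V.1 - V.2) / (1 - V.2))%R%:E * \int[mu]_p cst 1 p).
    exact: (@integral_corner (cst 1)).
  by rewrite integral1// probability_setT mule1.
have : mu D = mu [set W | in_corner V W] + mu [set W | in_cap V W].
  apply: measureU => //; [exact: measurable_in_corner|exact: measurable_in_cap|].
  by apply/seteqP; split=> // p [/and5P[_ _ _ _ r] /and5P[_ _ _ _ r']]; lra.
rewrite muD muC; case: (mu [set W | in_cap V W]) => [r|//|//].
rewrite -EFinD => -[E]; congr EFin.
have -> : (r = (1 - V.1 - V.2) / (1 - V.2) - V.2 * (1 - V.1 - V.2) / (1 - V.2))%R by lra.
by field; rewrite gt_eqF//; lra.
Qed.

End corner_measure.

(** * Recursion for the distribution of the number of vertices *)

Lemma side_leftC (R : realType) (V W : plane R) : side_left W V = - side_left V W.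
Proof. by rewrite /side_left; ring. Qed.

Definition in_triangle (R : realType) (p : plane R) : bool :=
  [&& 0 < p.1, 0 < p.2 & p.1 + p.2 < 1].

Lemma in_triangleP (R : realType) (p : plane R) : reflect (open_triangle p) (in_triangle p).
Proof. by apply: (iffP and3P) => -[]. Qed.

(** The first entry is the vertex adjacent to (0, 1), without ties: strict inequalities throughout
    make the geometric reduction valid pointwise. *)
Definition leads (R : realType) (s : seq (plane R)) : bool :=
  if s is V :: s' then
    in_triangle V && all (fun W => in_triangle W && (0 < side_left V W)) s'
  else false.

Lemma all_corner_cap (R : realType) (V : plane R) (s : seq (plane R)) :
  all (predU (in_corner V) (in_cap V)) s =
  all (fun W => in_triangle W && (0 < side_left V W)) s.
Proof.
apply: eq_all => W /=; rewrite /in_corner /in_cap /in_triangle -!andbA -!andb_orr leNgt.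
by rewrite orbN andbT.
Qed.

Lemma filter_corner (R : realType) (V : plane R) (s : seq (plane R)) :
  all (fun W => in_triangle W && (0 < side_left V W)) s ->
  [seq W <- s | in_corner V W] = [seq W <- s | 0 < side_right V W].
Proof.
move=> /allP sV; apply: eq_in_filter => W /sV /andP[/and3P[p1 p2 p3] l].
by rewrite /in_corner p1 p2 p3 l.
Qed.

Lemma count_vertices_leads (R : realType) (V : plane R) (s : seq (plane R)) :
  leads (V :: s) -> count_vertices (V :: s) =
    (count_vertices (map (corner_inv V) [seq W <- s | in_corner V W])).+1.
Proof.
move=> /andP[/in_triangleP TV sV]; rewrite filter_corner// count_vertices_cons//.
  by move=> W /(allP sV) /andP[/in_triangleP].
by move=> W /(allP sV) /andP[].
Qed.

Section leads_measurable.
Context (R : realType) d (T : measurableType d).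

Lemma measurable_leads (n : nat) (X : 'I_n -> T -> plane R) :
  (forall i, measurable_fun setT (X i)) ->
  measurable_fun setT (fun w => leads (codom (X^~ w))).
Proof.
have m1 (f : T -> plane R) : measurable_fun setT f ->
    measurable_fun setT (fun w => (f w).1 : measurableTypeR R).
  by move=> mf; apply: (measurableT_comp measurable_fst).
have m2 (f : T -> plane R) : measurable_fun setT f ->
    measurable_fun setT (fun w => (f w).2 : measurableTypeR R).
  by move=> mf; apply: (measurableT_comp measurable_snd).
have mT (f : T -> plane R) : measurable_fun setT f ->
    measurable_fun setT (fun w => in_triangle (f w)).
  move=> mf; have f1 := m1 _ mf; have f2 := m2 _ mf.
  apply: measurable_and; last apply: measurable_and.
  - exact: measurable_fun_ltr.
  - exact: measurable_fun_ltr.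
  - by apply: measurable_fun_ltr => //; exact: measurable_funD.
case: n X => [|n] X mX.
  rewrite (_ : (fun w => _) = cst false); first exact: measurable_cst.
  by apply/funext => w; rewrite codomE; case: (enum 'I_0) (enum_ord0) => // -[].
rewrite (_ : (fun w => _) = fun w => in_triangle (X ord0 w) &&
    all (fun i => in_triangle (X (lift ord0 i) w) &&
      (0 < side_left (X ord0 w) (X (lift ord0 i) w))) (enum 'I_n)); last first.
  by apply/funext => w; rewrite codomE enum_ordSl /= -map_comp all_map.
have f1 i := m1 _ (mX i); have f2 i := m2 _ (mX i).
apply: measurable_and; first exact: mT.
apply: measurable_all => i; apply: measurable_and; first exact: mT.
apply: measurable_fun_ltr => //.
apply: measurable_funB; last exact: f1.
apply: measurable_funD; apply: measurable_funM; [|exact: f1|exact: f1|exact: f2].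
by apply: measurable_funB => //; exact: f2.
Qed.

End leads_measurable.

Lemma codom_tnth (T : Type) (n : nat) (t : n.-tuple T) : codom (tnth t) = t.
Proof. by rewrite codomE map_tnth_enum. Qed.

Section recursion.
Context (R : realType) (mu : probability (plane R) R).
Local Open Scope ereal_scope.
Hypothesis muE : forall A : set (plane R), measurable A ->
  mu A = area R (A `&` triangle R) / area R (triangle R).

Lemma measurable_leads_tuple n :
  measurable_fun setT (fun t : n.-tuple (plane R) => leads t).
Proof.
rewrite (_ : (fun t => _) = fun t : n.-tuple (plane R) => leads (codom (tnth t))).
  apply: (@measurable_leads _ _ _ _ (fun i (t : n.-tuple (plane R)) => tnth t i)) => i.
  exact: measurable_tnth.
by apply/funext => t; rewrite codom_tnth.
Qed.

Lemma measurable_count_vertices n k :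
  measurable_fun setT (fun t : n.-tuple (plane R) => count_vertices t == k).
Proof.
apply: (measurable_fun_bool true); rewrite setTI.
rewrite (_ : _ @^-1` _ = [set t : n.-tuple (plane R) | f0 (tnth t) = k]).
  apply: (@measurable_f0 _ _ _ _ (fun i (t : n.-tuple (plane R)) => tnth t i)) => i.
  exact: measurable_tnth.
by apply/seteqP; split=> t /=; rewrite f0E codom_tnth => /eqP.
Qed.

(** Probability that, among n + 1 points, m remain below the line from the first vertex to (1,
    0). *)
Definition step_weight (n m : nat) : R :=
  (2 * (n.+1 - m)%:R / (n.+1%:R * n.+2%:R))%R.

(* Integrate over the vertex [V] adjacent to [(0, 1)]; given [V], the points below
   the line from [V] to [(1, 0)] form a rescaled copy of the original problem. *)
Lemma iint_leads (n : nat) (g h : seq (plane R) -> \bar R) :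
  (forall m, measurable_fun [set: m.-tuple (plane R)] (h \o val)) ->
  (forall s, 0 <= h s) ->
  (forall V s, leads (V :: s) ->
    g (V :: s) = h (map (corner_inv V) [seq W <- s | in_corner V W])) ->
  n.+1%:R%:E * iint mu n.+1 (fun s => if leads s then g s else 0) =
  \sum_(m < n.+1) (step_weight n m)%:E * iint mu m h.
Proof.
move=> mh h0 gh.
pose T := @open_triangle R.
have mT : measurable T := @measurable_open_triangle R.
pose D m (p : plane R) : R := ((p.2 / (1 - p.2)) ^+ m * (1 - p.1 - p.2) ^+ n)%R.
have mD m : measurable_fun T (EFin \o D m) by exact: measurable_triangle_density.
have D0 m p : T p -> (0 <= D m p)%R.
  by move=> [p1 p2 p3]; rewrite mulr_ge0// exprn_ge0 ?divr_ge0//; lra.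
have J0 m : 0 <= iint mu m h by exact: iint_ge0.
have -> : iint mu n.+1 (fun s => if leads s then g s else 0) =
    \int[mu]_(V in T) \sum_(m < n.+1) ('C(n, m)%:R%:E * (D m V)%:E * iint mu m h).
  rewrite [RHS]integral_mkcond; apply: eq_integral => V _; rewrite patchE.
  have TVE : (V \in T) = in_triangle V.
    by apply/idP/in_triangleP => [/set_mem|/mem_set].
  rewrite TVE; case: ifPn => [/[dup] tV /in_triangleP TV|/negPf tV]; last first.
    transitivity (iint mu n (fun=> 0)).
      by apply: iint_eq => s _; rewrite /leads tV.
    by elim: (n) => [//|k IHk] /=; rewrite integral0_eq.
  have [V1 V2 V3] := TV.
  transitivity (iint mu n (fun s => if all (predU (in_corner V) (in_cap V)) s
      then h (map (corner_inv V) [seq W <- s | in_corner V W]) else 0)).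
    apply: iint_eq => s _; rewrite all_corner_cap.
    have -> : leads (V :: s) = all (fun W => in_triangle W && (0 < side_left V W)%R) s.
      by rewrite /leads tV.
    by case: ifPn => // sV; rewrite gh// /leads tV.
  rewrite (iint_thinning (alpha := (V.2 * (1 - V.1 - V.2) / (1 - V.2))%R)
    (beta := (1 - V.1 - V.2)%R))//.
  - apply: eq_bigr => m _; congr (_ * _); rewrite -EFinM -mulrA; congr (_ * _)%R%:E.
    have mn : (m <= n)%N by rewrite -ltnS.
    have -> : D m V = ((V.2 / (1 - V.2)) ^+ m * ((1 - V.1 - V.2) ^+ m *
        (1 - V.1 - V.2) ^+ (n - m)))%R by rewrite -exprD subnKC.
    by rewrite mulrA -exprMn; congr (_ ^+ _ * _)%R; ring.
  - by move=> W /and5P[_ _ _ _ r]; rewrite /in_cap leNgt r !andbF.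
  - exact: measurable_in_corner.
  - exact: measurable_in_cap.
  - exact: measurable_funTS (measurable_corner_inv V).
  - by rewrite divr_ge0 ?mulr_ge0//; lra.
  - by lra.
  - by move=> f mf f0; exact: integral_corner.
  - exact: measure_cap.
rewrite ge0_integral_sum//; last 2 first.
- move=> m; apply: emeasurable_funM; last exact: measurable_cst.
  by apply: emeasurable_funM; [exact: measurable_cst|exact: mD].
- by move=> m V TV; rewrite !mule_ge0// lee_fin// D0.
rewrite ge0_sume_distrr; last first.
  by move=> m _; apply: integral_ge0 => V TV; rewrite !mule_ge0// lee_fin// D0.
apply: eq_bigr => m _.
have mn : (m <= n)%N by rewrite -ltnS.
rewrite ge0_integralZr//; last 2 first.
- by apply: emeasurable_funM; [exact: measurable_cst|exact: mD].
- by move=> V TV; rewrite mule_ge0// lee_fin// D0.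
rewrite (ge0_integralZl _ mT (mD m))//; last by move=> V TV; rewrite lee_fin D0.
rewrite (integral_uniform_triangle muE (mD m)); last by move=> V TV; rewrite lee_fin D0.
rewrite integral_open_triangle// !muleA -!EFinM; congr (_%:E * _).
(* n! = C(n, m) m! (n - m)! absorbs the factorials of the beta value and leaves the factor n + 1 -
   m; the 2 is the density of [mu]. *)
have := congr1 (fun k => k%:R : R) (bin_fact mn); rewrite !natrM.
rewrite /step_weight subSn// !factS !natrM => <-.
have nz k : (0 < k)%N -> (k%:R != 0 :> R)%R by rewrite pnatr_eq0 -lt0n.
move: (nz _ (fact_gt0 m)) (nz _ (fact_gt0 (n - m))) (nz 'C(n, m)) (nz n.+1) (nz n.+2).
rewrite bin_gt0 => + + /(_ mn) + /(_ isT) + /(_ isT).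
move: (m`!%:R)%R ((n - m)`!%:R)%R ('C(n, m)%:R)%R (n.+1%:R)%R (n.+2%:R)%R ((n - m).+1%:R)%R.
by move=> a b c e f x a0 b0 c0 e0 f0; field; rewrite a0 b0 c0 e0 f0.
Qed.

End recursion.

Lemma mutually_independent_perm (R : realType) (d d' : measure_display)
    (Omega : measurableType d) (S : measurableType d') (P : probability Omega R)
    (I : finType) (X : I -> {RV P >-> S}) (s : {perm I}) :
  mutually_independent X -> mutually_independent (fun i => X (s i)).
Proof.
move=> indX J A mA.
have := indX [set s i | i in J]%SET (fun j => A (s^-1%g j)) (fun j => mA _).
rewrite (big_imset _ (in2W (@perm_inj _ s))) /=.
rewrite (eq_bigr (fun i => P (X (s i) @^-1` A i))) => [<-|i _]; last by rewrite permK.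
congr (P _); apply/seteqP; split=> w wA /=.
  by move=> _ /imsetP[i iJ ->]; rewrite /= permK; exact: wA.
by move=> i iJ; have := wA (s i) (imset_f s iJ); rewrite /= permK.
Qed.

Lemma leads_codom (R : realType) (n : nat) (x : 'I_n.+1 -> plane R) :
  leads (codom x) -> forall j, j != ord0 -> 0 < side_left (x ord0) (x j).
Proof.
rewrite codomE enum_ordSl /= => /andP[_ /allP xV] j.
case: (unliftP ord0 j) => [i -> _|->]; last by rewrite eqxx.
have := xV (x (lift ord0 i)); rewrite -map_comp => /(_ (map_f _ (mem_enum _ i))).
by case/andP.
Qed.

Lemma count_vertices_perm (R : realType) (n : nat) (x : 'I_n -> plane R) (s : 'S_n) :
  count_vertices (codom (fun i => x (s i))) = count_vertices (codom x).
Proof.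
rewrite /count_vertices; congr (#|` fset_set (chain_vertices _) |)%fset.
apply/seteqP; split=> p /= /codomP[i ->]; first exact: codom_f.
by apply/codomP; exists (s^-1%g i); rewrite permKV.
Qed.

Lemma iint1 (R : realType) d (T : measurableType d) (mu : probability T R) (n : nat) :
  iint mu n (fun=> 1%E) = 1%E.
Proof.
elim: n => [//|n IH] /=; under eq_integral do rewrite IH.
by rewrite integral_cst// mul1e; exact: probability_setT.
Qed.

(** * Splitting the sample by its first vertex *)

Section chain.
Context (R : realType) (mu : probability (plane R) R).
Local Open Scope ereal_scope.
Hypothesis muE : forall A : set (plane R), measurable A ->
  mu A = area R (A `&` triangle R) / area R (triangle R).

Definition count_prob (n k : nat) : \bar R :=
  iint mu n (fun s => if count_vertices s == k then 1 else 0).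

(** The numerators add up to twice a triangular number. Total mass one later shows that the leading
    events exhaust the sample space. *)
Lemma sum_step_weight n : (\sum_(m < n.+1) step_weight R n m)%R = 1%R.
Proof.
have n1 k : (k.+1%:R != 0 :> R)%R by rewrite pnatr_eq0.
rewrite /step_weight -mulr_suml -mulr_sumr -natr_sum.
have E : (2 * \sum_(m < n.+1) (n.+1 - m) = n.+1 * n.+2)%N.
  elim: n => [|k IH]; first by rewrite big_ord1.
  rewrite big_ord_recl mulnDr subn0; under eq_bigr do rewrite lift0 subSS.
  by rewrite IH -mulnDl mulnC.
by rewrite -(natrM _ 2) E natrM divff// mulf_neq0.
Qed.

Section sample.
Context d (Omega : measurableType d) (P : probability Omega R) (n : nat).
Variable X : 'I_n -> {RV P >-> plane R}.
Hypothesis Xindep : mutually_independent X.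
Hypothesis Xunif : forall i, uniform_in (X i) (triangle R).

(** The permutation is there because each leading event sees the sample with [X i] swapped to the
    front. *)
Lemma prob_iint (b : pred (seq (plane R))) (s : 'S_n) :
  measurable_fun setT (fun t : n.-tuple (plane R) => b t) ->
  P [set w | b (codom (fun i => X (s i) w))] = iint mu n (fun s => if b s then 1 else 0).
Proof.
move=> mb.
have mh : measurable_fun [set: n.-tuple (plane R)]
    ((fun s => if b s then 1 else 0 : \bar R) \o val).
  by apply: (measurable_fun_ifT mb); exact: measurable_cst.
rewrite -(integral_iint (mutually_independent_perm s Xindep) _ mh)//; last 2 first.
- by move=> i A mA; rewrite Xunif// muE.
- by move=> l; case: ifP.
have mE : measurable [set w | b (codom (fun i => X (s i) w))].
  have mX : measurable_fun setT (fun w => [tuple X (s i) w | i < n]).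
    by apply: (@measurable_mktuple _ _ _ _ _ (fun i => X (s i) : Omega -> plane R)).
  rewrite (_ : [set w | _] = (fun w => [tuple X (s i) w | i < n]) @^-1`
    ((fun t : n.-tuple (plane R) => b t) @^-1` [set true])).
    rewrite -[X in measurable X]setTI; apply: mX => //.
    by rewrite -[X in measurable X]setTI; exact: mb.
  by apply/seteqP; split=> w /=; rewrite codomE.
transitivity (\int[P]_w (\1_[set w | b (codom (fun i => X (s i) w))] w)%:E).
  by rewrite integral_indic// setIT.
apply: eq_integral => w _; rewrite indicE.
have -> : (w \in [set w | b (codom (fun i => X (s i) w))]) = b (codom (fun i => X (s i) w)).
  by apply/idP/idP => [/set_mem|/mem_set].
by case: ifP.
Qed.

Lemma prob_count_vertices k : P [set w | f0 (X^~ w) = k] = count_prob n k.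
Proof.
rewrite /count_prob -(@prob_iint (fun s => count_vertices s == k) 1%g).
  congr (P _); apply/seteqP.
  by split=> w /=; rewrite f0E (count_vertices_perm (X^~ w)) => /eqP.
exact: measurable_count_vertices.
Qed.

End sample.

Section first_vertex_decomposition.
Context d (Omega : measurableType d) (P : probability Omega R) (n : nat).
Variable X : 'I_n.+1 -> {RV P >-> plane R}.
Hypothesis Xindep : mutually_independent X.
Hypothesis Xunif : forall i, uniform_in (X i) (triangle R).

(* By exchangeability the law of the sample seen from [X i] does not depend on [i]. *)
Let lead i : set Omega := [set w | leads (codom (fun j => X (tperm ord0 i j) w))].

Let measurable_lead i : measurable (lead i).
Proof.
have mb : measurable_fun setT (fun w => leads (codom (fun j => X (tperm ord0 i j) w))).
  by apply: (@measurable_leads _ _ _ _ (fun j => X (tperm ord0 i j) : Omega -> plane R)).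
by rewrite -[X in measurable X]setTI; exact: (mb measurableT [set true]).
Qed.

(** [side_left] is antisymmetric, so two different points cannot both lead. *)
Let trivIset_lead : trivIset setT lead.
Proof.
apply/trivIsetP => i j _ _ ij; apply/seteqP; split=> // w [/leads_codom li /leads_codom lj].
have ti : tperm ord0 i j != ord0.
  by apply: contra ij => /eqP e; rewrite -(tpermK ord0 i j) e tpermL.
have tj : tperm ord0 j i != ord0.
  by apply: contra ij => /eqP e; rewrite -(tpermK ord0 j i) e tpermL.
have := li _ ti; have := lj _ tj; rewrite !tpermK !tpermL (side_leftC (X i w)).
by lra.
Qed.

(** Permutation invariance of [b] gives all summands the same value, whence n + 1 times the integral
    with the first point leading. Applied to the trivial event and to the vertex counts. *)
Let lead_prob (b : pred (seq (plane R))) (h : seq (plane R) -> \bar R) :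
  measurable_fun setT (fun t : n.+1.-tuple (plane R) => b t) ->
  (forall (s : 'S_n.+1) x, b (codom (fun i => X (s i) x)) = b (codom (fun i => X i x))) ->
  (forall m, measurable_fun [set: m.-tuple (plane R)] (h \o val)) ->
  (forall s, 0 <= h s) ->
  (forall V s, leads (V :: s) -> (if b (V :: s) then 1 else 0) =
    h (map (corner_inv V) [seq W <- s | in_corner V W])) ->
  \sum_(i < n.+1) P (lead i `&` [set w | b (codom (X^~ w))]) =
  \sum_(m < n.+1) (step_weight R n m)%:E * iint mu m h.
Proof.
move=> mb bX mh h0 bh.
transitivity (\sum_(i < n.+1) iint mu n.+1
    (fun s => if leads s then if b s then 1 else 0 else 0)).
  apply: eq_bigr => i _.
  rewrite (@iint_eq _ _ _ _ _ _ (fun s => if leads s && b s then 1 else 0)); last first.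
    by move=> s _; case: leads.
  rewrite -(@prob_iint _ _ _ _ _ Xindep Xunif (fun s => leads s && b s) (tperm ord0 i)).
    by congr (P _); apply/seteqP; split=> w /=; rewrite bX => /andP.
  by apply: measurable_and => //; exact: measurable_leads_tuple.
rewrite -(iint_leads (g := fun s => if b s then 1 else 0) muE n mh h0 bh).
by elim: n.+1 (iint _ _ _) => [|k IH] x;
  rewrite ?big_ord0 ?mul0e// big_ord_recl IH !mule_natl muleS.
Qed.

(* Hence the [lead i] cover almost all of [Omega]: ties need no separate argument. *)
Let sum_lead : \sum_(i < n.+1) P (lead i) = 1.
Proof.
transitivity (\sum_(i < n.+1) P (lead i `&` [set w | xpredT (codom (X^~ w))])).
  by apply: eq_bigr => i _; congr (P _); apply/seteqP; split=> w // -[].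
rewrite (@lead_prob xpredT (fun=> 1)) //; last by move=> m; exact: measurable_cst.
under eq_bigr do rewrite iint1 mule1.
by rewrite sumEFin sum_step_weight.
Qed.

Let sum_leadI A : measurable A -> P A = \sum_(i < n.+1) P (lead i `&` A).
Proof.
move=> mA.
pose U := \big[setU/set0]_(i < n.+1) lead i.
have mU : measurable U by exact: bigsetU_measurable.
have PU : P U = 1 by rewrite measure_bigsetU_ord.
have PUC : P (~` U) = 0 by rewrite probability_setC// PU subee.
have -> : P A = P (U `&` A).
  apply/eqP; rewrite eq_le; apply/andP; split; last first.
    by apply: le_measure; rewrite ?inE//; exact: measurableI.
  rewrite -(@measureU0 _ _ _ P (U `&` A) (~` U))//; last 2 first.
  - exact: measurableI.
  - exact: measurableC.
  apply: le_measure; rewrite ?inE//.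
    by apply: measurableU; [exact: measurableI|exact: measurableC].
  by move=> w Aw; have [Uw|nUw] := pselect (U w); [left|right].
rewrite /U big_distrl /= measure_bigsetU_ord//.
  by move=> i; exact: measurableI.
exact: trivIset_setIr.
Qed.

Let measurable_f0X k : measurable [set w | f0 (X^~ w) = k].
Proof. exact: (@measurable_f0 _ _ _ _ (fun i => X i : Omega -> plane R)). Qed.

(** On each leading event the leader itself is a vertex. *)
Lemma prob_count_vertices0 : P [set w | f0 (X^~ w) = 0%N] = 0.
Proof.
rewrite sum_leadI// big1// => i _; rewrite (_ : _ `&` _ = set0) ?measure0//.
apply/seteqP; split=> // w [li]; rewrite /= f0E -(count_vertices_perm _ (tperm ord0 i)).
move: li; rewrite /lead /= codomE enum_ordSl /= => li.
by rewrite count_vertices_leads.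
Qed.

Lemma prob_count_verticesS k : P [set w | f0 (X^~ w) = k.+1] =
  \sum_(m < n.+1) (step_weight R n m)%:E * count_prob m k.
Proof.
rewrite sum_leadI//.
rewrite -(@lead_prob (fun s => count_vertices s == k.+1)
  (fun s => if count_vertices s == k then 1 else 0)).
- apply: eq_bigr => i _; congr (P (_ `&` _)); apply/seteqP.
  by split=> w /=; rewrite f0E => /eqP.
- exact: measurable_count_vertices.
- by move=> s x; rewrite (count_vertices_perm (fun i => X i x)).
- move=> m; apply: (measurable_fun_ifT (@measurable_count_vertices R m k));
    exact: measurable_cst.
- by move=> s; case: ifP.
- by move=> V s lVs; rewrite count_vertices_leads.
Qed.

End first_vertex_decomposition.
End chain.

(** * From the recursion to the generating functions *)

Section pgf.
Context (R : realType) (p : nat -> nat -> R) (z : R).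
Hypothesis p00 : p 0 0 = 1.
Hypothesis p0S : forall k, p 0 k.+1 = 0.
Hypothesis pS0 : forall n, p n.+1 0 = 0.
Hypothesis pSS : forall n k,
  p n.+1 k.+1 = \sum_(m < n.+1) step_weight R n m * p m k.

Let G n := \sum_(k < n.+1) p n k * z ^+ k.

(** Read off the recursion: each step removes one vertex and at least one point. *)
Let p_gt n k : (n < k)%N -> p n k = 0.
Proof.
elim: k n => [//|k IH] [|n] nk; first exact: p0S.
by rewrite pSS big1// => m _; rewrite IH ?mulr0//; exact: leq_trans (ltn_ord m) nk.
Qed.

(** Gives all G m with m <= n a common range of summation, so that the sums can be exchanged. *)
Let G_trunc n N : (n <= N)%N -> \sum_(k < N.+1) p n k * z ^+ k = G n.
Proof.
move=> nN; rewrite /G [RHS](big_ord_widen N.+1 (fun k => p n k * z ^+ k))//.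
rewrite [RHS]big_mkcond; apply: eq_bigr => k _; case: ifPn => //.
by rewrite -leqNgt => nk; rewrite p_gt// mul0r.
Qed.

Let S n := \sum_(m < n) (n - m)%:R * G m.

(** At index 0 both sides vanish, so the three-term recurrence may reach down to G 0. *)
Let G_S n : n%:R * (n%:R + 1) * G n = 2 * z * S n.
Proof.
case: n => [|n]; first by rewrite /S big_ord0 mulr0 !mul0r.
have -> : G n.+1 = z * \sum_(m < n.+1) step_weight R n m * G m.
  rewrite {1}/G big_ord_recl pS0 mul0r add0r.
  under eq_bigr => k _ do rewrite lift0 pSS exprS mulr_suml.
  rewrite exchange_big mulr_sumr; apply: eq_bigr => m _ /=.
  have mn : (m <= n)%N by rewrite -ltnS.
  rewrite -(G_trunc mn) !mulr_sumr; apply: eq_bigr => k _; ring.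
rewrite /S !mulr_sumr; apply: eq_bigr => m _.
rewrite /step_weight.
have n1 : (n.+1%:R != 0 :> R) by rewrite pnatr_eq0.
have n2 : (n.+2%:R != 0 :> R) by rewrite pnatr_eq0.
rewrite natr1; move: n1 n2.
move: (n.+1%:R) (n.+2%:R) ((n.+1 - m)%:R) => a b c a0 b0.
by field; rewrite a0 b0.
Qed.

(** The weights n - m are linear in n: the first difference of S is a plain sum of G, the second a
    single term. *)
Let S_second_difference n : S n.+2 = 2 * S n.+1 - S n + G n.+1.
Proof.
have dS k : S k.+1 = S k + \sum_(m < k.+1) G m.
  rewrite /S !big_ord_recr /= subSnn mul1r addrA; congr (_ + _).
  rewrite -big_split; apply: eq_bigr => m _ /=.
  by rewrite subSn 1?ltnW// -natr1 mulrDl mul1r.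
rewrite dS [in RHS]dS big_ord_recr /= (dS n); ring.
Qed.

Lemma pgf_recurrence n :
  G n.+2 = (coef_a R n.+2 * z + coef_b R n.+2) * G n.+1 - coef_c R n.+2 * G n.
Proof.
have n0 : (0 : R) <= n%:R by [].
apply: (mulfI (_ : n.+2%:R * (n.+2%:R + 1) != 0)).
  by rewrite mulf_neq0// gt_eqF// -natr1; lra.
rewrite G_S S_second_difference.
have -> : 2 * z * (2 * S n.+1 - S n + G n.+1) =
  2 * (2 * z * S n.+1) - 2 * z * S n + 2 * z * G n.+1 by ring.
(* With N = n + 2 this reads N (N + 1) G N = 2 (N - 1) N G (N - 1) - (N - 2) (N - 1) G (N - 2) + 2 z
   G (N - 1); dividing by N (N + 1) gives the coefficients. *)
rewrite -!G_S /coef_a /coef_b /coef_c -!natr1.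
by field; rewrite !gt_eqF//; lra.
Qed.

End pgf.

Theorem theorem1 (R : realType) (d : nat -> measure_display)
    (Omega : forall n : nat, measurableType (d n))
    (P : forall n : nat, probability (Omega n) R)
    (X : forall n : nat, 'I_n -> {RV (P n) >-> plane R})
    (Xindep : forall n : nat, mutually_independent (X n))
    (Xunif : forall (n : nat) (i : 'I_n), uniform_in (X n i) (triangle R)) :
  let G := fun (n : nat) (z : R) => chain_pgf (X n) z in
  (forall z : R, G 0%N z = 1) /\
  (forall z : R, G 1%N z = z) /\
  (forall (n : nat) (z : R), (2 <= n)%N ->
     G n z = (coef_a R n * z + coef_b R n) * G n.-1 z - coef_c R n * G n.-2 z).
Proof.
move=> G.
(* The probability spaces vary with n, but all points have the same law; the single point of the
   sample of size one provides it as a measure on the plane. *)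
pose mu : probability (plane R) R := distribution (P 1%N) (X 1%N ord0).
have muE A : measurable A -> mu A =
    (area R (A `&` triangle R) / area R (triangle R))%E by exact: Xunif.
pose p n k := chain_prob (X n) k.
have pE n k : count_prob mu n k = (p n k)%:E.
  rewrite -(prob_count_vertices muE (Xindep n) (Xunif n)) /p /chain_prob fineK//.
  apply: fin_num_measure.
  exact: (@measurable_f0 _ _ _ _ (fun i => X n i : Omega n -> plane R)).
have p0 k : p 0%N k = (k == 0%N)%:R.
  apply: EFin_inj; rewrite -pE /count_prob /=.
  rewrite (_ : count_vertices [::] = 0%N); first by rewrite eq_sym; case: eqP.
  rewrite /count_vertices (_ : chain_vertices _ = set0) ?fset_set0//.
  by apply/seteqP; split=> // q /chain_vertices_sub.
have pS0 n : p n.+1 0%N = 0.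
  by rewrite /p /chain_prob (prob_count_vertices0 muE (Xindep _) (Xunif _)).
have pSS n k : p n.+1 k.+1 = \sum_(m < n.+1) step_weight R n m * p m k.
  apply: EFin_inj; rewrite -pE -(prob_count_vertices muE (Xindep _) (Xunif _)).
  rewrite (prob_count_verticesS muE (Xindep _) (Xunif _)) -sumEFin.
  by apply: eq_bigr => m _; rewrite EFinM pE.
(* The term k = 0, absent from [chain_pgf], is 1 for n = 0 and vanishes for larger n. *)
have GE n z : G n z = \sum_(k < n.+1) p n k * z ^+ k.
  case: n => [|n]; first by rewrite big_ord1 p0 expr0 mulr1.
  by rewrite /G /chain_pgf big_ord_recl /= pS0 mul0r add0r big_add1 big_mkord.
split; first by [].
split.
  move=> z; rewrite GE big_ord_recr big_ord1 /= pS0 mul0r add0r expr1.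
  by rewrite pSS big_ord1 p0 mulr1 /step_weight subn0; field.
move=> n z; case: n => [|[|n]] // _; rewrite !GE.
by apply: pgf_recurrence => //.
Qed.
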